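(* Let $A_\Gamma$ be a one-ended right-angled Artin group and let $H$ be a finitely generated subgroup of $A_\Gamma$. Then $H$ is strongly quasiconvex in $A_\Gamma$ if and only if $H$ has finite height in $A_\Gamma$.
   Context: Right-angled Artin group: for a finite simplicial graph $\Gamma$, $A_\Gamma$ is the group generated by the vertices of $\Gamma$ with relations $st=ts$ whenever $s,t$ are adjacent vertices. Height: the height of a subgroup $H$ of a group $G$ is the smallest number $n$ with the property that for any $n+1$ distinct left cosets $g_1H,\dots,g_{n+1}H$ the intersection $\bigcap_i g_iHg_i^{-1}$ is finite. $H$ has finite height in $G$ if such an $n$ exists. A $(K,C)$-quasi-geodesic in a metric space $Y$ is a map $f\colon I\to Y$ from a subinterval $I$ of $\mathbb{R}$ or $\mathbb{Z}$ with $\frac1K|s-t|-C\le d(f(s),f(t))\le K|s-t|+C$ for all $s,t\in I$; quasi-geodesics in a finitely generated group are taken in a Cayley graph for a finite generating set. A subgroup $H$ of a finitely generated group $G$ is strongly quasiconvex if for every $K\ge1$, $C\ge0$ there is $M=M(K,C)$ such that every $(K,C)$-quasi-geodesic in $G$ with endpoints on $H$ is contained in the $M$-neighborhood of $H$. *)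

(* Defs.v *)
From HB Require Import structures.
From mathcomp Require Import all_boot all_order all_algebra.
From mathcomp Require Import all_classical all_reals all_analysis.

Set Implicit Arguments.
Unset Strict Implicit.
Unset Printing Implicit Defensive.

Import Order.TTheory GRing.Theory Num.Theory.

Local Open Scope classical_set_scope.
Local Open Scope group_scope.

(** The group with generators [X] and relations [u = v] for [rels u v].
    A letter [(x, true)] stands for [x] and [(x, false)] for its inverse. *)
Section Presentation.
Variables (X : choiceType).

Definition word := seq (X * bool).

Variable rels : word -> word -> Prop.

Inductive pres_eq : word -> word -> Prop :=
| pres_refl u : pres_eq u u
| pres_sym u v : pres_eq u v -> pres_eq v u
| pres_trans u v w : pres_eq u v -> pres_eq v w -> pres_eq u w
| pres_cat u u' v v' : pres_eq u u' -> pres_eq v v' ->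
    pres_eq (u ++ v) (u' ++ v')
| pres_cancel x b : pres_eq [:: (x, b); (x, ~~ b)] [::]
| pres_rel u v : rels u v -> pres_eq u v.

Definition pres_eqb : rel word := fun u v => `[< pres_eq u v >].

Lemma pres_eqb_refl : reflexive pres_eqb.
Proof. by move=> u; apply/asboolP/pres_refl. Qed.

Lemma pres_eqb_sym : symmetric pres_eqb.
Proof. by move=> u v; apply/asboolP/asboolP; apply: pres_sym. Qed.

Lemma pres_eqb_trans : transitive pres_eqb.
Proof.
by move=> v u w /asboolP uv /asboolP vw; apply/asboolP/(pres_trans uv vw).
Qed.

Canonical pres_equiv :=
  EquivRel pres_eqb pres_eqb_refl pres_eqb_sym pres_eqb_trans.

Definition presented : Type := {eq_quot pres_equiv}%qT.

HB.instance Definition _ := Choice.on presented.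

Definition pres_class (u : word) : presented := \pi_({eq_quot pres_equiv})%qT u.
Definition pres_repr (g : presented) : word :=
  repr (g : {eq_quot pres_equiv}%qT).

Definition inv_word (u : word) : word := rev [seq (a.1, ~~ a.2) | a <- u].

Definition pres_one : presented := pres_class [::].
Definition pres_mul (g h : presented) : presented :=
  pres_class (pres_repr g ++ pres_repr h).
Definition pres_inv (g : presented) : presented :=
  pres_class (inv_word (pres_repr g)).

Lemma pres_reprK g : pres_class (pres_repr g) = g.
Proof. exact: reprK. Qed.

Lemma pres_classP u v : pres_class u = pres_class v <-> pres_eq u v.
Proof. by split=> [/eqmodP/asboolP|uv]; last apply/eqmodP/asboolP. Qed.

Lemma pres_repr_class u : pres_eq (pres_repr (pres_class u)) u.
Proof. by apply/pres_classP; rewrite pres_reprK. Qed.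

Lemma pres_class_cat u v :
  pres_mul (pres_class u) (pres_class v) = pres_class (u ++ v).
Proof. by apply/pres_classP/pres_cat; apply: pres_repr_class. Qed.

Lemma pres_inv_wordr u : pres_eq (u ++ inv_word u) [::].
Proof.
elim: u => [|[x b] u IHu]; first exact: pres_refl.
rewrite /inv_word /= rev_cons -cats1 -cat1s !catA.
apply: (pres_trans _ (pres_cancel x b)).
rewrite -[in X in pres_eq _ X]cat1s; apply: pres_cat (pres_refl _).
rewrite -[[:: (x, b)] in X in pres_eq _ X]cats0 -!catA.
by apply: pres_cat => //; apply: pres_refl.
Qed.

Lemma inv_wordK : involutive inv_word.
Proof.
move=> u; rewrite /inv_word map_rev revK -map_comp -[RHS]map_id.
by apply: eq_map => -[x b] /=; rewrite negbK.
Qed.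

Lemma pres_mulA : associative pres_mul.
Proof.
move=> f g h; rewrite -[f]pres_reprK -[g]pres_reprK -[h]pres_reprK.
by rewrite !pres_class_cat catA.
Qed.

Lemma pres_mul1g : left_id pres_one pres_mul.
Proof. by move=> g; rewrite -[g in LHS]pres_reprK pres_class_cat pres_reprK. Qed.

Lemma pres_mulg1 : right_id pres_one pres_mul.
Proof.
by move=> g; rewrite -[g in LHS]pres_reprK pres_class_cat cats0 pres_reprK.
Qed.

Lemma pres_mulgV : right_inverse pres_one pres_inv pres_mul.
Proof.
move=> g; rewrite -[X in pres_mul X _]pres_reprK pres_class_cat.
exact/pres_classP/pres_inv_wordr.
Qed.

Lemma pres_mulVg : left_inverse pres_one pres_inv pres_mul.
Proof.
move=> g; rewrite -[X in pres_mul _ X]pres_reprK pres_class_cat.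
apply/pres_classP; rewrite -[X in _ ++ X]inv_wordK.
exact: pres_inv_wordr.
Qed.

HB.instance Definition _ := isGroup.Build presented
  pres_mulA pres_mul1g pres_mulg1 pres_mulVg pres_mulgV.

End Presentation.

Inductive raag_rel (V : finType) (e : rel V) : word V -> word V -> Prop :=
| raag_commute s t : e s t ->
    raag_rel e [:: (s, true); (t, true)] [:: (t, true); (s, true)].

Definition raag (V : finType) (e : rel V) : groupType :=
  presented (raag_rel e).

Section Groups.
Variable G : groupType.
Implicit Types (S : seq G) (H K : set G).

Definition is_subgroup H := group_closed (mem H).

Definition generated S : set G := smallest is_subgroup [set` S].

Definition generates S := generated S = setT.

Definition finitely_generated H := exists S, H = generated S.

Definition left_coset (g : G) H : set G := [set g * h | h in H].
Definition conj_set (g : G) H : set G := [set g * h * g^-1 | h in H].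

Definition height_bound H (n : nat) :=
  forall g : 'I_n.+1 -> G, injective (fun i => left_coset (g i) H) ->
    finite_set (\bigcap_(i in [set: 'I_n.+1]) conj_set (g i) H).

Definition has_height H (n : nat) :=
  height_bound H n /\ forall m, height_bound H m -> (n <= m)%N.

Definition finite_height H := exists n, has_height H n.

(** The (simplicial) Cayley graph of [G] with respect to [S]. *)
Definition cayley_adj S : rel G :=
  fun x y => (x != y) && ((x^-1 * y \in S) || (y^-1 * x \in S)).

Definition component S K (x : G) : set G :=
  [set y | exists p, [/\ path (cayley_adj S) x p, last x p = y &
                         forall z, z \in x :: p -> ~ K z]].

(** The complement of every finite set of vertices of the Cayley graph has
    exactly one infinite component; this does not depend on [S]. *)
Definition one_ended := exists2 S, generates S &
  forall K, finite_set K ->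
    exists! C : set G, infinite_set C /\ exists x, C = component S K x.

End Groups.

Section CayleyGraph.
Local Open Scope ring_scope.
Variables (R : realType) (G : groupType) (S : seq G).

(** Geometric realization of the Cayley graph: [CEdge x y t] is the interior
    point at distance [t] from [x] on the edge from [x] to [y].  It is the same
    point as [CEdge y x (1 - t)]; these are not identified, but they are at
    distance 0 for [cayley_dist], which is a pseudometric. *)
Inductive cayley : Type :=
| CVertex of G
| CEdge (x y : G) (t : R) of cayley_adj S x y & 0 < t < 1.

Definition vertex_dist (x y : G) : R :=
  inf [set (size p)%:R | p in [set p | path (cayley_adj S) x p /\
                                       last x p = y]].

(** The vertices nearest to a point along its edge, with their distances. *)
Definition exits (p : cayley) : seq (G * R) :=
  match p with
  | CVertex x => [:: (x, 0)]
  | CEdge x y t _ _ => [:: (x, t); (y, 1 - t)]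
  end.

Definition along_edge (p q : cayley) : set R :=
  match p, q with
  | CEdge x y t _ _, CEdge x' y' t' _ _ =>
      [set r | (x = x' /\ y = y' /\ r = `|t - t'|) \/
               (x = y' /\ y = x' /\ r = `|t - (1 - t')|)]
  | _, _ => set0
  end.

Definition cayley_dist (p q : cayley) : R :=
  inf (along_edge p q `|`
       [set a.2 + vertex_dist a.1 b.1 + b.2 | a in [set` exits p]
                                            & b in [set` exits q]]).

End CayleyGraph.

Section Quasiconvexity.
Local Open Scope ring_scope.
Variable R : realType.

(** Subintervals of the reals or of the integers. *)
Definition real_or_int_interval (I : set R) :=
  exists J : set R, is_interval J /\ (I = J \/ I = J `&` [set` Num.int]).

(** Only the values of [f] on [I] matter. *)
Definition quasi_geodesic (Y : Type) (d : Y -> Y -> R) (K C : R)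
    (I : set R) (f : R -> Y) :=
  real_or_int_interval I /\
  forall s t, I s -> I t ->
    K^-1 * `|s - t| - C <= d (f s) (f t) <= K * `|s - t| + C.

Definition endpoints (I : set R) (a b : R) :=
  [/\ I a, I b & forall t, I t -> a <= t <= b].

(** The choice of the finite generating set [S] is immaterial, since all
    constants [K] and [C] are considered. *)
Definition strongly_quasiconvex (G : groupType) (H : set G) :=
  exists2 S : seq G, generates S &
  forall K C : R, 1 <= K -> 0 <= C ->
  exists M : R, forall (I : set R) (f : R -> cayley R S) (a b : R),
    quasi_geodesic (@cayley_dist R G S) K C I f ->
    endpoints I a b ->
    (exists2 h, H h & f a = CVertex R S h) ->
    (exists2 h, H h & f b = CVertex R S h) ->
    forall t, I t -> exists2 h, H h & cayley_dist (f t) (CVertex R S h) <= M.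

End Quasiconvexity.

(* Main.v *)
Require Import Defs.
From mathcomp Require Import all_boot all_order all_algebra.
From mathcomp Require Import all_classical all_reals all_analysis.
From mathcomp Require Import zify lra.

Import Order.TTheory GRing.Theory Num.Theory.

(* If H is strongly quasiconvex and k lies in many conjugates g_i H g_i^-1, with k
   long compared with the g_i, then a geodesic from 1 to k can be completed by short
   detours to a uniform quasi-geodesic with endpoints g_i and k g_i on g_i H.  Hence a
   fixed point of the geodesic is uniformly close to every coset g_i H, which bounds
   their number.

   Conversely let H have finite height.  One-endedness makes the graph connected.  If
   z commutes with a nontrivial element of a conjugate of H, then a bounded power of z
   lies in that conjugate.  If some nontrivial element of H is conjugate into a join
   subgroup, this propagates along the graph: a fixed power of every vertex lies in
   every conjugate of H, and H has finite index.

   Otherwise H meets trivially the conjugates of join subgroups, in particular the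
   stabilizers of the walls of the Cayley graph.  So the steps at which a word geodesic
   of H crosses a given wall are close to each other, and, by induction on J, boundedly
   many of its steps cross walls dual to a fixed coset of a standard parabolic subgroup
   A_J contained in a join.  Therefore a geodesic of H crosses, at bounded distances, a
   chain of strongly separated walls: no wall crosses two of them.  Any path that
   crosses two consecutive walls of the chain quickly has to do so near H, whence a
   quasi-geodesic with endpoints on H stays close to H. *)

Set Implicit Arguments.
Unset Strict Implicit.
Unset Printing Implicit Defensive.

Local Open Scope classical_set_scope.
Local Open Scope group_scope.

(** * Word metrics *)

Section CayleyDistance.
Variables (G : groupType) (S : seq G).
Implicit Types (x y z g : G) (p : seq G).

Local Notation adj := (cayley_adj S).

Lemma adjM g x y : adj (g * x) (g * y) = adj x y.
Proof.
rewrite /cayley_adj !invgM -!mulgA !mulKg; congr (_ && _).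
by rewrite (inj_eq (mulgI g)).
Qed.

Lemma adjC x y : adj x y = adj y x.
Proof. by rewrite /cayley_adj eq_sym orbC. Qed.

(** [S] need not generate: linked points are those of one left coset of [generated S], so the same
    distance serves for the group and, with generators of [H], for [H]. *)
Definition linked x y := exists2 p, path adj x p & last x p = y.

Lemma linkedM g x y : linked x y -> linked (g * x) (g * y).
Proof.
move=> [p xp <-]; exists (map ( *%g g) p); last by rewrite last_map.
by rewrite path_map (eq_path (e' := adj)) // => a b /=; apply: adjM.
Qed.

Lemma path_rev x p : path adj x p ->
  path adj (last x p) (rev (belast x p)) /\ last (last x p) (rev (belast x p)) = x.
Proof.
move=> xp; rewrite rev_path (eq_path (e' := adj)) //; last by move=> a b /=; apply: adjC.
split=> //; case: p {xp} => //= y p; by rewrite rev_cons last_rcons.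
Qed.

Lemma linkedC x y : linked x y -> linked y x.
Proof. by move=> [p /path_rev[q1 q2] <-]; exists (rev (belast x p)). Qed.

Lemma linkedD x y z : linked x y -> linked y z -> linked x z.
Proof.
move=> [p xp <-] [q yq <-]; exists (p ++ q); last by rewrite last_cat.
by rewrite cat_path xp.
Qed.

Lemma subgroup_mem (H : set G) : is_subgroup H ->
  [/\ H 1, (forall x y, H x -> H y -> H (x * y)) & (forall x, H x -> H x^-1)].
Proof.
move=> Hs; have [H1 HD] := Hs.
have memH x : H x <-> x \in mem H by rewrite in_setE.
split; first exact/memH.
- move=> x y /memH Hx /memH Hy; apply/memH.
  exact: (group_closedM Hs).
- by move=> x /memH Hx; apply/memH; apply: (group_closedV Hs).
Qed.

Lemma subgroup_intro (H : set G) : H 1 -> (forall x y, H x -> H y -> H (x * y^-1)) ->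
  is_subgroup H.
Proof.
move=> H1 HD; split=> [|x y]; rewrite ?in_setE //.
exact: HD.
Qed.

(** The elements linked to 1 form a subgroup containing [S]. *)
Lemma generated_linked x y : generated S (x^-1 * y) -> linked x y.
Proof.
suff H g : generated S g -> linked 1 g.
  by move/H/(linkedM x); rewrite mulg1 mulVKg.
move=> Sg; apply: (Sg [set g | linked 1 g]); split.
  apply: subgroup_intro => [|a b la lb]; first by exists [::].
  apply: linkedD la _; apply: linkedC.
  by have := linkedM (a * b^-1) lb; rewrite mulg1 mulgVK.
move=> s /= sS; have [->|s1] := eqVneq s 1; first by exists [::].
by exists [:: s]; rewrite //= /cayley_adj eq_sym s1 invg1 mul1g sS.
Qed.

Lemma linked_generated x y : linked x y -> generated S (x^-1 * y).
Proof.
move=> [p xp <-] H [Hs SH]; have [H1 HM HV] := subgroup_mem Hs.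
elim: p x xp => [|z p IHp] x /=; first by rewrite mulVg.
case/andP => /andP[_ xz] zp; rewrite -(mulgK z x^-1) -mulgA.
rewrite (_ : x^-1 * z * (z^-1 * _) = x^-1 * z * (z^-1 * last z p)) //.
apply: HM; last exact: IHp.
case/orP: xz => [/SH //|/SH /HV]; by rewrite invgM invgK.
Qed.

Lemma cdist_subproof x y : linked x y ->
  exists n, `[< exists2 p, path adj x p /\ last x p = y & size p = n >].
Proof. by move=> [p xp py]; exists (size p); apply/asboolP; exists p. Qed.

(* Equal to 0 when there is no path from [x] to [y]. *)
Definition cdist x y : nat :=
  if pselect (linked x y) is left xy then ex_minn (cdist_subproof xy) else 0.

Lemma cdist_path x y : linked x y ->
  exists p, [/\ path adj x p, last x p = y & size p = cdist x y].
Proof.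
rewrite /cdist; case: pselect => // xy _; case: ex_minnP => n /asboolP[p [xp py] <-] _.
by exists p.
Qed.

Lemma cdist_le x p : path adj x p -> cdist x (last x p) <= size p.
Proof.
rewrite /cdist; case: pselect => // xy xp; case: ex_minnP => n _; apply.
by apply/asboolP; exists p.
Qed.

Lemma cdistpp x : cdist x x = 0.
Proof. by apply/eqP; rewrite -leqn0; apply: (@cdist_le x [::]). Qed.

Lemma cdistD x y z : linked x y -> linked y z ->
  cdist x z <= cdist x y + cdist y z.
Proof.
move=> /cdist_path[p [xp py <-]] /cdist_path[q [yq qz <-]].
rewrite -size_cat -qz -py -last_cat; apply: cdist_le.
by rewrite cat_path xp py.
Qed.

Lemma cdistM g x y : linked x y -> cdist (g * x) (g * y) = cdist x y.
Proof.
have le h a b : linked a b -> cdist (h * a) (h * b) <= cdist a b.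
  move=> /cdist_path[p [ap <- <-]]; rewrite -(size_map ( *%g h)) -last_map.
  by apply: cdist_le; rewrite path_map (eq_path (e' := adj)) // => c d /=; apply: adjM.
move=> xy; apply/eqP; rewrite eqn_leq le //=.
by rewrite -{1}(mulKg g x) -{1}(mulKg g y) le //; apply: linkedM.
Qed.

Lemma cdistC x y : linked x y -> cdist x y = cdist y x.
Proof.
have le a b : linked a b -> cdist b a <= cdist a b.
  move=> /cdist_path[p [/path_rev[ba q] <- <-]].
  by rewrite -{2}q (leq_trans (cdist_le ba)) // size_rev size_belast.
by move=> xy; apply/eqP; rewrite eqn_leq !le //; apply: linkedC.
Qed.

(** Subpaths bound the distances from above; the triangle inequality along a shortest path turns
    these bounds into equalities. *)
Lemma cdist_geodesic x y : linked x y -> exists f : nat -> G,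
  [/\ f 0 = x, f (cdist x y) = y & forall i j, i <= j <= cdist x y ->
     linked (f i) (f j) /\ cdist (f i) (f j) = j - i].
Proof.
move=> xy; have [p [xp py sp]] := cdist_path xy.
pose f i := nth x (x :: p) i; exists f.
have fn : f (size p) = y by rewrite /f -(last_nth x).
have sub i j : i <= j <= size p -> linked (f i) (f j) /\ cdist (f i) (f j) <= j - i.
  move=> ij; have fp : path adj (f i) (take (j - i) (drop i p)).
    have := xp; rewrite -{1}(cat_take_drop i p) cat_path => /andP[_].
    rewrite -{1}(cat_take_drop (j - i) (drop i p)) cat_path => /andP[+ _].
    by rewrite /f (last_nth x) size_takel; [|lia]; case: (i) ij => [//|i' ij] /=;
      rewrite nth_take.
  have lst : last (f i) (take (j - i) (drop i p)) = f j.
    rewrite (last_nth x) size_takel ?size_drop; last lia.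
    case E: (j - i) => [|k] /=; first by rewrite /f (_ : i = j) //; lia.
    by rewrite nth_take // nth_drop /f (_ : j = (i + k).+1) //; lia.
  split; first by exists (take (j - i) (drop i p)).
  rewrite -lst; apply: leq_trans (cdist_le fp) _.
  by rewrite size_takel // size_drop; lia.
rewrite -sp; split=> // i j ij; have [l1 d1] := sub i j ij; split=> //.
have [|l0 d0] := sub 0 i; first lia. have [|l2 d2] := sub j (size p); first lia.
have := cdistD (linkedD l0 l1) l2; have := cdistD l0 l1.
have : cdist (f 0) (f (size p)) = size p by rewrite fn -sp.
by lia.
Qed.

Lemma cdist_ball n : exists s : seq G, forall y, linked 1 y -> cdist 1 y <= n -> y \in s.
Proof.
elim: n => [|n [s sP]].
  exists [:: 1] => y /cdist_path[p [xp <-]]; rewrite leqn0 => <-.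
  by move/eqP/size0nil ->; rewrite inE.
exists (s ++ [seq a * b | a <- s, b <- S ++ [seq c^-1 | c <- S]]) => y /cdist_path[p [xp py sz]].
rewrite -sz; elim/last_ind: p xp py {sz} => [_ <- _|p z _].
  rewrite mem_cat sP ?cdistpp //; by exists [::].
rewrite rcons_path last_rcons size_rcons ltnS mem_cat => /andP[xp /andP[_ pz]] zy pn.
apply/orP; right; apply/allpairsP; exists (last 1 p, (last 1 p)^-1 * y); split=> /=.
- by apply: sP; [exists p|apply: leq_trans (cdist_le xp) pn].
- rewrite mem_cat -zy; case/orP: pz => [->//|H].
  by apply/orP; right; apply/mapP; exists (z^-1 * last 1 p); rewrite // invgM invgK.
- by rewrite mulVKg.
Qed.

Lemma generates_linked x y : generates S -> linked x y.
Proof. by move=> Sg; apply: generated_linked; rewrite Sg. Qed.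

Lemma vertex_distE (R : realType) x y : linked x y ->
  vertex_dist R S x y = (cdist x y)%:R%R.
Proof.
move=> xy; have [p [xp py sp]] := cdist_path xy.
apply/eqP; rewrite eq_le; apply/andP; split.
  apply: ge_inf; last by exists p; rewrite // sp.
  by exists 0%R => _ [q _ <-]; apply: ler0n.
apply: lb_le_inf; first by exists (size p)%:R%R; exists p.
by move=> _ [q [xq <-] <-]; rewrite ler_nat cdist_le.
Qed.

End CayleyDistance.

(** * Strongly quasiconvex subgroups have finite height *)

Section FiniteHeight.
Variables (R : realType) (G : groupType).
Implicit Types (H : set G) (S : seq G) (x y z g k : G).

Lemma height_bound_finite H n : height_bound H n -> finite_height H.
Proof.
move=> hn; have ex : exists m, `[< height_bound H m >] by exists n; apply/asboolP.
case: (ex_minnP ex) => m /asboolP hm mmin; exists m; split=> // j hj.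
by apply: mmin; apply/asboolP.
Qed.

Lemma cayley_dist_vertex S x y :
  cayley_dist (CVertex R S x) (CVertex R S y) = vertex_dist R S x y.
Proof.
rewrite /cayley_dist /= set0U (_ : [set _ | _ in _ & _ in _] = [set vertex_dist R S x y]).
  exact: inf1.
apply/seteqP; split=> [r [a +] [b +]|r ->] /=.
  rewrite /mkset !mem_seq1 => /eqP -> /eqP -> <- /=; by rewrite add0r addr0.
by exists (x, 0%R); rewrite /= ?inE //; exists (y, 0%R); rewrite /= ?inE // add0r addr0.
Qed.

Lemma nat_ub (M : R) : exists n : nat, (M <= n%:R)%R.
Proof.
exists (Num.bound `|M|%R); apply: le_trans (ler_norm M) _.
exact/ltW/archi_boundP/normr_ge0.
Qed.

(** A sequence on 0, ..., N is a quasi-geodesic on the integer points of the real interval [0, N].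
    Additive constant 0 is enough for the detours below. *)
Lemma strongly_quasiconvex_nat H : strongly_quasiconvex R H ->
  exists2 S, generates S & forall K, 0 < K -> exists M : nat, forall N (w : nat -> G),
  (forall i j, i <= j <= N -> j - i <= (K * cdist S (w i) (w j))%N /\
     cdist S (w i) (w j) <= (K * (j - i))%N) ->
  H (w 0) -> H (w N) ->
  forall i, i <= N -> exists2 h, H h & cdist S (w i) h <= M.
Proof.
case=> S Sg qS; exists S => // K K0.
have lk x y := generates_linked x y Sg.
have [||M hM] := qS K%:R%R 0%R; rewrite ?ler1n //.
have [n Mn] := nat_ub M; exists n => N w qw Hw0 HwN i iN.
pose I : set R := `[0%R, N%:R%R]%classic `&` [set` Num.int].
have In (j : nat) : j <= N -> I j%:R%R.
  by move=> jN; split; rewrite /= ?intr_nat // in_itv /= ler0n ler_nat.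
have nI t : I t -> exists2 j : nat, j <= N & t = j%:R%R.
  move=> [/=]; rewrite in_itv /= => /andP[t0 tN] ti.
  have tnat : t \is a Num.nat by rewrite natrEint ti.
  by exists (Num.truncn t); rewrite ?truncnK // -(ler_nat R) truncnK.
pose f (t : R) := CVertex R S (w (Num.truncn t)).
have fd i1 i2 : cayley_dist (f i1%:R%R) (f i2%:R%R) = (cdist S (w i1) (w i2))%:R%R.
  by rewrite cayley_dist_vertex vertex_distE // !natrK.
have qf : quasi_geodesic (@cayley_dist R G S) K%:R%R 0%R I f.
  split; first by exists `[0%R, N%:R%R]%classic; split; [exact: interval_is_interval|right].
  move=> _ _ /nI[i1 i1N ->] /nI[i2 i2N ->]; rewrite fd.
  wlog le12 : i1 i2 i1N i2N / i1 <= i2.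
    move=> wl; have [/wl->//|/ltnW/(wl _ _ i2N i1N)] := leqP i1 i2.
    by rewrite distrC cdistC.
  have [|lo up] := qw i1 i2; first lia.
  rewrite distrC ger0_norm ?subr_ge0 ?ler_nat // -natrB // subr0 addr0.
  rewrite -natrM ler_nat up andbT ler_pdivrMl ?ltr0n // -natrM ler_nat //.
have ends : endpoints I 0%R N%:R%R.
  split; [exact: (In 0)|exact: In|].
  by move=> t [/=]; rewrite in_itv.
have [] := hM I f 0%R N%:R%R qf ends _ _ i%:R%R (In i iN).
- by exists (w 0); rewrite /f ?truncn0.
- by exists (w N); rewrite /f // natrK.
move=> h Hh; rewrite /f natrK cayley_dist_vertex vertex_distE // => le.
by exists h => //; rewrite -(ler_nat R); apply: le_trans le Mn.
Qed.

(* Nearest point projections to a long geodesic yield a quasi-geodesic with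
   uniform constants: the detours at both ends are short compared with the part of
   the geodesic in between. *)
Lemma detour S (c : nat -> G) l D x y : generates S ->
  (forall i j, i <= j <= l -> cdist S (c i) (c j) = j - i) ->
  cdist S x (c 0) <= D -> cdist S y (c l) <= D -> 8 * D <= l ->
  exists N (w : nat -> G) i, [/\ w 0 = x, w N = y, i <= N, w i = c (2 * D)%N &
    forall i j, i <= j <= N -> j - i <= (3 * cdist S (w i) (w j))%N /\
      cdist S (w i) (w j) <= (3 * (j - i))%N].
Proof.
move=> Sg cd xD yD lD.
have lk u v := generates_linked u v Sg; pose d := cdist S.
have dC u v : d u v = d v u by apply: cdistC.
have dD v u z : d u z <= d u v + d v z by apply: cdistD.
have nearest z : exists2 i, i <= l & forall j, j <= l -> d z (c i) <= d z (c j).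
  case: (arg_minnP (P := xpredT) (i0 := @ord0 l) (fun j : 'I_l.+1 => d z (c j)) isT).
  move=> i _ imin; exists i; first by rewrite -ltnS.
  move=> j jl; have jl' : j < l.+1 by [].
  exact: (imin (Ordinal jl')).
have [ip ipl ipmin] := nearest x; have [iq iql iqmin] := nearest y.
have [al [al0 al1 ald]] := cdist_geodesic (lk x (c ip)).
have [be [be0 be1 bed]] := cdist_geodesic (lk (c iq) y).
set a := cdist S x (c ip) in al1 ald; set b := cdist S (c iq) y in be1 bed.
have aD : a <= D by apply: leq_trans (ipmin 0 _) xD.
have bE : b = d y (c iq) by rewrite dC.
have bD : b <= D by rewrite bE; apply: leq_trans (iqmin l _) yD.
have {}cd i j : i <= j <= l -> d (c i) (c j) = j - i by apply: cd.
have {}ald i j : i <= j <= a -> d (al i) (al j) = j - i by case/ald.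
have {}bed i j : i <= j <= b -> d (be i) (be j) = j - i by case/bed.
(* The nearest points lie within 2D of the ends of the geodesic, so the part between them has length
   at least 4D and contains [c (2 * D)]. *)
have ipD : ip <= 2 * D.
  have := dD x (c 0) (c ip); rewrite cd ?ipl // (dC _ x) subn0 -/a => h.
  by move: xD aD h; rewrite -/d -/(d x _) /a -/(d _ _); lia.
have iqD : l - iq <= 2 * D.
  have := dD y (c iq) (c l); rewrite cd ?iql ?leqnn // (dC _ y) -bE => h.
  by move: yD bD h; rewrite -/d; lia.
pose w t := if t <= a then al t else if t <= a + (iq - ip) then c (ip + (t - a))%N
  else be (t - a - (iq - ip))%N.
pose m := iq - ip; have mE : iq = (ip + m)%N by rewrite /m; lia.
have w1 t : t <= a -> w t = al t by rewrite /w => ->.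
have w2 t : a <= t <= a + m -> w t = c (ip + (t - a))%N.
  rewrite /w -/m => /andP[h1 ->]; case: leqP => // h2.
  have -> : t = a by lia.
  by rewrite al1 subnn addn0.
have w3 t : a + m <= t -> w t = be (t - a - m)%N.
  rewrite /w -/m => h; case: leqP => [h1|_].
    have -> : t = a by lia.
    by rewrite subnn sub0n be0 al1 mE; congr c; lia.
  case: leqP => // h1; have -> : (t - a - m = 0)%N by lia.
  by rewrite be0 mE; congr c; lia.
exists (a + m + b)%N, w, (a + (2 * D - ip))%N; split.
- by rewrite w1.
- rewrite w3 ?leq_addr //.
  by rewrite -be1; congr be; lia.
- lia.
- by rewrite w2; [congr c|]; lia.
move=> i j /andP[ij jN]; rewrite -/d.
have [ja|aj] := leqP j a.
  by rewrite !w1 ?(leq_trans ij) // ald ?ij //; lia.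
have [ia|ai] := leqP i a.
  have di : d (al i) (c ip) = a - i by rewrite -al1 ald // ia leqnn.
  have dx : d x (al i) = i by rewrite -al0 ald ?subn0.
  rewrite (w1 i ia); have [jm|mj] := leqP j (a + m).
    (* With t the distance from [al i] to [z], minimality of [c ip] gives a - i <= t, hence j - a <=
       2t and j - i <= 3t. *)
    rewrite w2 ?(ltnW aj) //; set z := c _.
    have dz : d (c ip) z = j - a by rewrite cd; lia.
    have zmin : a <= d x z by apply: ipmin; lia.
    have := dD (al i) x z; have := dD (c ip) (al i) z; have := dD (al i) (c ip) z.
    rewrite (dC (c ip) (al i)); lia.
  (* Both detours have length at most D and m >= 4D: the distance is at least m - 2D >= m/2, while j
     - i <= m + 2D <= 3m/2. *)
  rewrite w3 ?(ltnW mj) //; set z := be _.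
  have dz : d (c iq) z = j - a - m by rewrite -be0 bed; lia.
  have dm : d (c ip) (c iq) = m by rewrite cd; lia.
  have := dD (c ip) (al i) z; have := dD (c iq) (c ip) z.
  have := dD (al i) (c ip) (c iq); have := dD z (al i) (c iq).
  rewrite (dC (c ip) (al i)) (dC z (c iq)); lia.
have [jm|mj] := leqP j (a + m).
  by rewrite !w2 ?cd; lia.
have [im|mi] := leqP i (a + m).
  rewrite w2 ?(ltnW ai) // w3 ?(ltnW mj) //; set u := c _; set z := be _.
  have dz : d (c iq) z = j - a - m by rewrite -be0 bed; lia.
  have dzy : d z y = b - (j - a - m) by rewrite -be1 bed; lia.
  have du : d u (c iq) = (a + m) - i by rewrite cd; lia.
  have umin : d y (c iq) <= d y u by apply: iqmin; lia.
  have := dD (c iq) u z; have := dD z u (c iq); have := dD z y u.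
  have := dD u (c iq) z; rewrite (dC (c iq) u).
  rewrite (dC y z) (dC z (c iq)) (dC z u) dzy; move: umin; rewrite -bE; lia.
by rewrite !w3 ?bed; lia.
Qed.

(** Only as many cosets as a ball of radius [M] has elements can come within [M] of one point. An
    infinite intersection of conjugates supplies the long element whose geodesic contains such a
    point. *)
Lemma finite_height_of_nat_quasiconvex H S : is_subgroup H -> generates S ->
  (exists M : nat, forall N (w : nat -> G),
  (forall i j, i <= j <= N -> j - i <= (3 * cdist S (w i) (w j))%N /\
     cdist S (w i) (w j) <= (3 * (j - i))%N) ->
  H (w 0) -> H (w N) ->
  forall i, i <= N -> exists2 h, H h & cdist S (w i) h <= M) -> finite_height H.
Proof.
move=> Hs Sg [M hM]; have [H1 HM HV] := subgroup_mem Hs.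
have lk x y := generates_linked x y Sg; pose d := cdist S.
have dC x y : d x y = d y x by apply: cdistC.
have dD y x z : d x z <= d x y + d y z by apply: cdistD.
have dM g x y : d (g * x) (g * y) = d x y by apply: cdistM.
have [s sP] := cdist_ball S M; apply: (@height_bound_finite H (size s)).
move=> g ginj; apply: contrapT => inf.
pose D := \max_(i < (size s).+1) d (g i) 1%g.
have gD i : d (g i) 1%g <= D by apply: (leq_bigmax i).
have [k kI kD] : exists2 k, (forall i, conj_set (g i) H k) & 8 * D < d 1%g k.
  apply: contrapT => nk; apply: inf; have [t tP] := cdist_ball S (8 * D).
  apply: (sub_finite_set (B := [set` t])); last exact: finite_seq.
  move=> k kI /=; apply: tP => //; rewrite leqNgt; apply/negP => kD; apply: nk.
  by exists k => // i; apply: kI.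
have [c [c0 cl cd]] := cdist_geodesic (lk 1 k); set l := cdist S 1 k in cl cd.
have {}cd i j : i <= j <= l -> d (c i) (c j) = j - i by case/cd.
pose m := c (2 * D)%N.
(* Translation by the inverse of [g i] moves the ends [g i] and [k * g i] of the detour into [H], as
   [k] lies in the conjugate by [g i]. *)
have near i : exists2 h, H h & d m (g i * h) <= M.
  have [h Hh kE] := kI i; pose x := g i; pose y := k * g i.
  have dx : d x 1%g <= D by exact: gD.
  have dy : d y k <= D by rewrite /y -{2}(mulg1 k) dM.
  have {}kD : 8 * D <= l by apply: ltnW.
  have dx0 : cdist S x (c 0) <= D by rewrite c0.
  have dyl : cdist S y (c l) <= D by rewrite cl.
  have [N [w [t [w0 wN tN wt qw]]]] := detour Sg cd dx0 dyl kD.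
  have [|||h' Hh'] := hM N (fun i => x^-1 * w i) _ _ _ t tN.
  - by move=> a b /qw; rewrite -/d dM.
  - by rewrite w0 mulVg.
  - by rewrite wN /y -kE /x; rewrite -!mulgA mulVg mulg1 mulKg.
  by rewrite wt -/m -/d -(dM x) mulVKg => le; exists h'.
have /choice[h hP] : forall i, exists h, H h /\ d m (g i * h) <= M.
  by move=> i; have [h] := near i; exists h.
pose r i := m^-1 * (g i * h i).
have rinj : injective r.
  move=> i j /mulgI E; apply: ginj; have [Hi _] := hP i; have [Hj _] := hP j.
  apply/seteqP; split=> _ [a Ha <-].
    exists (h j * (h i)^-1 * a); first exact/HM/Ha/HM/HV.
    by rewrite !mulgA -E mulgK.
  exists (h i * (h j)^-1 * a); first exact/HM/Ha/HM/HV.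
  by rewrite !mulgA E mulgK.
have : size [seq r i | i <- enum 'I_(size s).+1] <= size s.
  apply: uniq_leq_size; first by rewrite map_inj_uniq // enum_uniq.
  move=> z /mapP[i _ ->]; have [_ mM] := hP i; apply: sP => //.
  by rewrite -/d -(dM m) /r mulVKg mulg1.
by rewrite size_map size_enum_ord ltnn.
Qed.

Theorem strongly_quasiconvex_finite_height H : is_subgroup H ->
  strongly_quasiconvex R H -> finite_height H.
Proof.
move=> Hs /strongly_quasiconvex_nat[S Sg /(_ 3 isT)].
exact: finite_height_of_nat_quasiconvex.
Qed.

End FiniteHeight.

(** * From quasi-geodesics in the Cayley graph to sequences of group elements *)

Section Discretization.
Variables (R : realType) (G : groupType) (S : seq G).
Hypothesis Sg : generates S.
Local Open Scope ring_scope.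

Let d (x y : G) : R := (cdist S x y)%:R.

Let lk x y : linked S x y := generates_linked x y Sg.

Let dD (y x z : G) : d x z <= d x y + d y z.
Proof. by rewrite /d -natrD ler_nat; apply: cdistD. Qed.

Let dC (x y : G) : d x y = d y x. Proof. by rewrite /d cdistC. Qed.

Let d_adj (x y : G) : cayley_adj S x y -> d x y <= 1.
Proof.
move=> xy; rewrite /d -[1]/(1%:R) ler_nat.
by apply: (@cdist_le _ S x [:: y]); rewrite /= xy.
Qed.

Definition near_vertex (p : cayley R S) : G :=
  match p with CVertex x => x | CEdge x _ _ _ _ => x end.

Lemma exits_near (p : cayley R S) : exists2 r, 0 <= r <= 1 &
  (near_vertex p, r) \in exits p.
Proof.
case: p => [x|x y t xy t01] /=; first by exists 0; rewrite ?lexx ?ler01 ?inE.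
by exists t; rewrite ?inE ?eqxx //; case/andP: t01 => t0 t1; rewrite !ltW.
Qed.

Lemma exitsP (p : cayley R S) a : a \in exits p ->
  d (near_vertex p) a.1 <= 1 /\ 0 <= a.2.
Proof.
have d0 x : d x x <= 1 by rewrite /d cdistpp.
case: p => [x|x y t xy t01] /=; first by rewrite inE => /eqP ->.
case/andP: t01 => t0 t1; rewrite !inE => /orP[] /eqP -> /=.
  by split; [exact: d0|exact: ltW].
by split; [exact: d_adj|rewrite subr_ge0 ltW].
Qed.

Let cayley_set (p q : cayley R S) : set R := along_edge p q `|`
  [set a.2 + vertex_dist R S a.1 b.1 + b.2 | a in [set` exits p] & b in [set` exits q]].

(** Passing to the near vertices costs at most 1 at each end; for points of one edge the near
    vertices are equal or adjacent. *)
Lemma cayley_set_ge (p q : cayley R S) r : cayley_set p q r ->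
  d (near_vertex p) (near_vertex q) - 2 <= r.
Proof.
case=> [|[a /= /exitsP[pa a0] [b /exitsP[qb b0] <-]]]; last first.
  rewrite vertex_distE // -/(d _ _) lerBlDr.
  have := dD a.1 (near_vertex p) (near_vertex q).
  have := dD b.1 a.1 (near_vertex q); rewrite (dC b.1); lra.
case: p q => [x|x y t xy t01] [x'|x' y' t' xy' t01'] //= [[<- [_ ->]]|[_ [<- ->]]].
  rewrite /d cdistpp; have := normr_ge0 (t - t'); lra.
have := normr_ge0 (t - (1 - t')); have := d_adj xy; lra.
Qed.

Lemma cayley_dist_le (p q : cayley R S) :
  cayley_dist p q <= d (near_vertex p) (near_vertex q) + 2.
Proof.
have [r /andP[r0 r1] pr] := exits_near p; have [s /andP[s0 s1] qs] := exits_near q.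
apply: le_trans (_ : r + d (near_vertex p) (near_vertex q) + s <= _); last lra.
apply: ge_inf.
  by exists (d (near_vertex p) (near_vertex q) - 2) => z /cayley_set_ge.
right; exists (near_vertex p, r) => //; exists (near_vertex q, s) => //=.
by rewrite vertex_distE.
Qed.

Lemma cayley_dist_ge (p q : cayley R S) :
  d (near_vertex p) (near_vertex q) <= cayley_dist p q + 2.
Proof.
rewrite -lerBlDr; apply: lb_le_inf; last by move=> z /cayley_set_ge.
have [r _ pr] := exits_near p; have [s _ qs] := exits_near q.
exists (r + vertex_dist R S (near_vertex p) (near_vertex q) + s); right.
by exists (near_vertex p, r) => //; exists (near_vertex q, s).
Qed.

(** Sampling at unit steps and moving each sample to a vertex only changes the constants. *)
Lemma nat_strongly_quasiconvex (H : set G) :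
  (forall K C : nat, exists M : nat, forall N (w : nat -> G),
  (forall i j, (i <= j <= N)%N -> (j - i <= K * cdist S (w i) (w j) + C)%N /\
     (cdist S (w i) (w j) <= K * (j - i) + C)%N) ->
  H (w 0%N) -> H (w N) ->
  forall i, (i <= N)%N -> exists2 h, H h & (cdist S (w i) h <= M)%N) ->
  strongly_quasiconvex R H.
Proof.
move=> hH; exists S => // K C K1 C0.
have K0 : 0 < K by apply: lt_le_trans K1.
(* The lower bound gives t j - t i <= K (d + 2 + C), and j - i <= t j - t i + 1, whence K (C + 2) +
   1. *)
have [k Kk] := nat_ub K; have [c Cc] := nat_ub (K * (C + 2) + 1).
(* K + C pays for the way from the preceding sample, and 4 for two passages to near vertices. *)
have [M hM] := hH k c; exists (K + C + 4 + M%:R) => I f a b [[J [Jint IJ]] qf] ends fa fb.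
have [Ia Ib Iab] := ends; have ab : a <= b by case/andP: (Iab b Ib).
(* Capping at [b] makes the last sample an endpoint; only the last step can be shorter than 1, and
   the samples are integers when the domain consists of integers. *)
pose n := Num.truncn (b - a); pose t (i : nat) : R := Num.min (a + i%:R) b.
have ba0 : 0 <= b - a by rewrite subr_ge0.
have /andP[nb bn] : n%:R <= b - a < n.+1%:R by apply: truncn_itv.
have t0 : t 0%N = a by rewrite /t addr0 min_l.
have tn : t n.+1 = b by rewrite /t min_r // -lerBlDl ltW.
have ta i : a <= t i by rewrite /t le_min ab lerDl ler0n.
have tb i : t i <= b by rewrite /t ge_min lexx orbT.
have It i : I (t i).
  have Jt : J a -> J b -> J (t i) by move=> Ja Jb; apply: (Jint a b) => //; rewrite ta tb.
  case: IJ => IE; move: Ia Ib; rewrite IE; first by [].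
  move=> [Ja az] [Jb bz]; split; first exact: Jt.
  rewrite /= in az bz *; rewrite /t minEle; case: ifP => // _.
  by apply: rpredD => //; apply: intr_nat.
have tlip i j : (i <= j <= n.+1)%N -> (j - i)%:R - 1 <= t j - t i <= (j - i)%:R.
  case/andP=> ij jn; rewrite natrB //.
  have ijR : i%:R <= j%:R :> R by rewrite ler_nat.
  have jnR : j%:R <= n.+1%:R :> R by rewrite ler_nat.
  rewrite -natr1 in jnR; rewrite /t !minEle; case: ifP => h1; case: ifP => h2; lra.
pose w i := near_vertex (f (t i)).
have wE h (p : cayley R S) : p = CVertex R S h -> near_vertex p = h by move=> ->.
have Kf x y : I x -> I y -> `|x - y| - 1 <= 0 -> cayley_dist (f x) (f y) <= K + C.
  move=> Ix Iy xy; have /andP[_ up] := qf x y Ix Iy; apply: le_trans up _.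
  by rewrite lerD2r -[leRHS]mulr1 ler_pM2l // -subr_le0.
have qw i j : (i <= j <= n.+1)%N -> (j - i <= k * cdist S (w i) (w j) + c)%N /\
    (cdist S (w i) (w j) <= k * (j - i) + c)%N.
  move=> ij; have /andP[lo up] := qf (t j) (t i) (It j) (It i).
  have /andP[tlo tup] := tlip i j ij.
  have ji0 : 0 <= (j - i)%:R :> R by apply: ler0n.
  have tt : 0 <= t j - t i.
    rewrite subr_ge0 /t le_min tb andbT; apply: le_trans (_ : a + i%:R <= _).
      by rewrite ge_min lexx.
    by rewrite lerD2l ler_nat; case/andP: ij.
  rewrite ger0_norm // in lo up.
  have dlo := cayley_dist_ge (f (t j)) (f (t i)).
  have dup := cayley_dist_le (f (t j)) (f (t i)).
  rewrite -/(w i) -/(w j) dC in dlo dup.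
  have dwE : d (w i) (w j) = (cdist S (w i) (w j))%:R by [].
  have dw0 : 0 <= d (w i) (w j) by apply: ler0n.
  split; rewrite -(ler_nat R) natrD natrM -dwE.
    have : t j - t i <= K * (d (w i) (w j) + 2 + C).
      by rewrite -ler_pdivrMl //; lra.
    have : K * d (w i) (w j) <= k%:R * d (w i) (w j) by rewrite ler_wpM2r.
    rewrite !mulrDr in Cc *; lra.
  have : K * (t j - t i) <= k%:R * (j - i)%:R.
    by apply: ler_pM => //; apply: ltW.
  have : C + 2 <= K * (C + 2) by rewrite ler_peMl //; lra.
  lra.
have Hw0 : H (w 0%N) by have [h Hh E] := fa; rewrite /w t0 (wE h).
have Hwn : H (w n.+1) by have [h Hh E] := fb; rewrite /w tn (wE h).
move=> s Is; have /andP[as_ sb] := Iab s Is; pose i := Num.truncn (s - a).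
have /andP[is1 is2] : i%:R <= s - a < i.+1%:R.
  by apply: truncn_itv; rewrite subr_ge0.
have iN : (i <= n.+1)%N.
  by apply/leqW/le_truncn; rewrite lerD2r.
have [h Hh wh] := hM n.+1 w qw Hw0 Hwn i iN; exists h => //.
apply: le_trans (cayley_dist_le _ _) _; rewrite /=.
have tiE : t i = a + i%:R by rewrite /t min_l //; lra.
have : cayley_dist (f s) (f (t i)) <= K + C.
  apply: Kf => //; rewrite tiE -natr1 in is2 *.
  by rewrite ger0_norm; lra.
have := cayley_dist_ge (f s) (f (t i)); have := dD (w i) (near_vertex (f s)) h.
have : d (w i) h <= M%:R by rewrite ler_nat.
rewrite -/(w i); lra.
Qed.

End Discretization.

(** * Counting, and the density of good times *)

Lemma bounded_seq (T : eqType) (s : seq T) (P : T -> nat -> Prop) :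
  (forall x m n, m <= n -> P x m -> P x n) ->
  (forall x, x \in s -> exists n, P x n) ->
  exists n, forall x, x \in s -> P x n.
Proof.
move=> Pm; elim: s => [|x s IHs] sP; first by exists 0.
have [y ys|n nP] := IHs; first by apply: sP; rewrite inE ys orbT.
have [m mP] := sP x (mem_head _ _).
exists (maxn m n) => y; rewrite inE => /orP[/eqP ->|/nP].
  by apply: Pm mP; apply: leq_maxl.
by apply: Pm; apply: leq_maxr.
Qed.

Lemma card_min n (P : {pred 'I_n}) N :
  (forall i, i \in P -> #|[pred j in P | i <= j]| <= N) -> #|P| <= N.
Proof.
move=> PN; case: (pickP (mem P)) => [i0 Pi0|P0]; last by rewrite eq_card0.
case: (arg_minnP (fun i : 'I_n => i : nat) Pi0) => i Pi imin.
apply: leq_trans (PN i Pi); apply: subset_leq_card; apply/fintype.subsetP => j Pj.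
by rewrite !inE /=; apply/andP; split=> //; apply: imin.
Qed.

Lemma card_max n (P : {pred 'I_n}) N :
  (forall i, i \in P -> #|[pred j in P | j <= i]| <= N) -> #|P| <= N.
Proof.
move=> PN; case: (pickP (mem P)) => [i0 Pi0|P0]; last by rewrite eq_card0.
case: (arg_maxnP (fun i : 'I_n => i : nat) Pi0) => i Pi imax.
apply: leq_trans (PN i Pi); apply: subset_leq_card; apply/fintype.subsetP => j Pj.
by rewrite !inE /=; apply/andP; split=> //; apply: imax.
Qed.

Lemma size_flatten_map (T : eqType) (S : Type) (f : T -> seq S) (s : seq T) N :
  (forall x, x \in s -> size (f x) <= N) ->
  size (flatten [seq f x | x <- s]) <= size s * N.
Proof.
elim: s => //= x s IHs sN; rewrite size_cat mulSn leq_add ?sN ?mem_head //.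
by apply: IHs => y ys; rewrite sN // inE ys orbT.
Qed.

Lemma cardU_le (T : finType) (A B : {pred T}) : #|[predU A & B]| <= #|A| + #|B|.
Proof. by rewrite -cardUI leq_addr. Qed.

(* The times [T j] at which [delta] is large advance faster than a quasi-geodesic
   can, so the good times, those with [delta (T j)] bounded, are dense. *)
Lemma good_times_dense (K C C1 A : nat) : exists M, forall m N (T delta : nat -> nat),
  T 0 = 0 -> T m.+1 = N -> (forall j, j <= m -> T j <= T j.+1) ->
  delta 0 <= C1 -> delta m.+1 <= C1 ->
  (forall j, 0 < j <= m -> delta j <= K * (T j.+1 - T j) + C1)%N ->
  (forall i j, i <= j <= m.+1 ->
    T j - T i <= K * (delta i + A * (j - i) + delta j) + C)%N ->
  forall i, i <= N -> exists j, [/\ j <= m.+1, T j <= i <= T j + M & delta j <= M].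
Proof.
(* Where [delta] exceeds [R0], the time step exceeds [G0]. As [G0] is larger than K A, two
   successive good indices differ by at most [r0]. *)
pose G0 := (K * A).+1; pose R0 := (K * G0 + C1)%N.
pose r0 := (2 * K * R0 + C + G0)%N.
exists (K * (2 * R0 + A * r0) + C + R0)%N.
move=> m N T delta T0 TN Tm d0 dN dj TT i iN.
have C1R : C1 <= R0 by exact: leq_addl.
have ex1 : exists j, [&& j <= m.+1, delta j <= R0 & T j <= i].
  by exists 0; rewrite T0 (leq_trans d0).
have ub1 j : [&& j <= m.+1, delta j <= R0 & T j <= i] -> j <= m.+1 by case/and3P.
(* [j1] is the last good index with [T j1 <= i], and [j2] below is the first good index after it;
   all indices in between are bad. *)
case: (ex_maxnP ex1 ub1) => j1 /and3P[j1m d1 T1] max1.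
exists j1; split=> //; last by apply: leq_trans d1 _; exact: leq_addl.
rewrite T1 /=; move: (j1m); rewrite leq_eqVlt => /orP[/eqP j1E|lt1].
  by apply: leq_trans (leq_addr _ _); rewrite j1E TN.
have ex2 : exists j, [&& j1 < j, j <= m.+1 & delta j <= R0].
  by exists m.+1; rewrite lt1 leqnn (leq_trans dN).
case: (ex_minnP ex2) => j2 /and3P[j12 j2m d2] min2.
have iT : i < T j2.
  by rewrite ltnNge; apply/negP => T2; have := max1 j2; rewrite j2m d2 T2; lia.
have grow k : j1 < k <= j2 -> T j1 + G0 * (k - j1.+1) <= T k.
  elim: k => // k IHk /andP[]; rewrite ltnS leq_eqVlt => /orP[/eqP <- _|j1k kj2].
    by rewrite subnn muln0 addn0 Tm //; lia.
  have {}IHk := IHk (introT andP (conj j1k (ltnW kj2))).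
  have dk : R0 < delta k.
    by rewrite ltnNge; apply/negP => dk; have := min2 k; rewrite j1k dk; lia.
  have : G0 < T k.+1 - T k.
    rewrite ltnNge; apply/negP => le; have := dj k; rewrite (_ : 0 < k <= m); last lia.
    have : K * (T k.+1 - T k) <= K * G0 by rewrite leq_mul2l le orbT.
    by rewrite /R0 in dk => ? /(_ isT); lia.
  by rewrite subSn // mulnS; lia.
have := grow j2; rewrite j12 leqnn => /(_ isT); have := TT j1 j2.
rewrite ltnW // j2m => /(_ isT).
have [r rE] : exists r, j2 = (j1 + r.+1)%N by exists (j2 - j1.+1); lia.
have -> : j2 - j1 = r.+1 by lia. have -> : j2 - j1.+1 = r by lia.
(* At least G0 r time has passed, but the quasi-geodesic inequality allows only K (2 R0 + A (r + 1))
   + C; this bounds r. *)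
move=> up low.
have KB : K * (delta j1 + A * r.+1 + delta j2) <= K * (2 * R0 + A * r.+1).
  by rewrite leq_mul2l; apply/orP; right; lia.
have rr0 : r.+1 <= r0.
  move: up low KB; rewrite /r0 /G0 !mulnDr !mulSn mulnS !mulnDr; lia.
have : K * (2 * R0 + A * r.+1) <= K * (2 * R0 + A * r0).
  by rewrite leq_mul2l leq_add2l leq_mul2l rr0 !orbT.
lia.
Qed.

Lemma eq_set_mem (T : Type) (A B : set T) :
  (forall x, (x \in A) = (x \in B)) -> A = B.
Proof.
move=> AB; apply/seteqP; split=> x xA; apply: set_mem; last rewrite AB.
  by rewrite -AB; apply: mem_set.
exact: mem_set.
Qed.

Lemma commute_conj (G : groupType) (a b : G) :
  commute a (a * (b * a^-1)) -> a * (b * a^-1) = b.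
Proof.
by rewrite /commute => /(congr1 (fun z => a^-1 * z)); rewrite -!mulgA mulVg mulg1 !mulKg.
Qed.

(** * Words and the elements they represent *)

Section Raag.
Variables (V : finType) (e : rel V).
Hypotheses (e_sym : symmetric e) (e_irr : irreflexive e).
Local Notation G := (raag e).
Implicit Types (x y : V) (l m : V * bool) (u v : word V) (g h k p q r w z : G).
Implicit Types (J K : {pred V}) (c d : set G).

Definition el u : G := pres_class (raag_rel e) u.
Definition lt l : G := el [:: l].

Lemma el_cat u v : el (u ++ v) = el u * el v.
Proof. by rewrite /el -pres_class_cat. Qed.

Lemma el_nil : el [::] = 1. Proof. by []. Qed.

Lemma el_cons l u : el (l :: u) = lt l * el u.
Proof. by rewrite -el_cat. Qed.

Lemma el_rcons u l : el (rcons u l) = el u * lt l.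
Proof. by rewrite -cats1 el_cat. Qed.

Lemma el_inv u : el (inv_word u) = (el u)^-1.
Proof.
apply: (mulgI (el u)); rewrite mulgV -el_cat.
exact/pres_classP/pres_inv_wordr.
Qed.

Lemma el_repr k : el (pres_repr k) = k. Proof. exact: pres_reprK. Qed.

Lemma lt_inv x b : lt (x, ~~ b) = (lt (x, b))^-1.
Proof.
apply: (mulgI (lt (x, b))); rewrite mulgV -[RHS]el_nil -el_cat.
exact/pres_classP/pres_cancel.
Qed.

Lemma lt_comm l m : e l.1 m.1 -> commute (lt l) (lt m).
Proof.
case: l => x b; case: m => y b' /= exy.
have h : commute (lt (x, true)) (lt (y, true)).
  rewrite /commute -!el_cat; apply/pres_classP/pres_rel; exact: raag_commute.
have h1 : commute (lt (x, b)) (lt (y, true)).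
  case: b => //; rewrite (lt_inv x true).
  exact/commute_sym/commuteV/commute_sym.
by case: b' => //; rewrite (lt_inv y true); apply: commuteV.
Qed.

(** * Standard parabolic subgroups *)

Definition parabolic J : set G :=
  [set k | exists2 u, el u = k & all (fun l => l.1 \in J) u].

Lemma parabolic_el J u : all (fun l => l.1 \in J) u -> parabolic J (el u).
Proof. by move=> uJ; exists u. Qed.

Lemma parabolic1 J : parabolic J 1. Proof. by exists [::]. Qed.

Lemma parabolicM J k h : parabolic J k -> parabolic J h -> parabolic J (k * h).
Proof.
move=> [u <- uJ] [v <- vJ]; rewrite -el_cat; apply: parabolic_el.
by rewrite all_cat uJ.
Qed.

Lemma parabolicV J k : parabolic J k -> parabolic J k^-1.
Proof.
move=> [u <- uJ]; rewrite -el_inv; apply: parabolic_el.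
by rewrite /inv_word all_rev all_map; apply: sub_all uJ.
Qed.

Lemma parabolicMl J k h : parabolic J k ->
  parabolic J (k * h) <-> parabolic J h.
Proof.
move=> Jk; split=> [Jkh|]; last exact: parabolicM.
by rewrite -(mulKg k h); apply: parabolicM => //; apply: parabolicV.
Qed.

Lemma parabolicMr J k h : parabolic J k ->
  parabolic J (h * k) <-> parabolic J h.
Proof.
move=> Jk; split=> [Jkh|Jh]; last exact: parabolicM.
by rewrite -(mulgK k h); apply: parabolicM => //; apply: parabolicV.
Qed.

Lemma parabolic_sub J K k : {subset J <= K} -> parabolic J k -> parabolic K k.
Proof.
by move=> JK [u <- uJ]; apply: parabolic_el; apply: sub_all uJ => l /JK.
Qed.

Lemma parabolic_comm J K k h : {in J & K, forall x y, e x y} ->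
  parabolic J k -> parabolic K h -> commute k h.
Proof.
move=> JK [u <- uJ] [v <- vK].
elim: u uJ => [_|l u IHu /= /andP[lJ uJ]]; first exact/commute_sym/commute1.
rewrite el_cons; apply/commute_sym/commuteM; last exact/commute_sym/IHu.
elim: v vK {IHu} => [_|m v IHv /= /andP[mK vK]]; first exact/commute_sym/commute1.
rewrite el_cons; apply/commute_sym/commuteM; last exact/commute_sym/IHv.
exact/lt_comm/JK.
Qed.

(** Deleting the letters outside [J] respects the relations and so gives the retraction of the group
    onto [parabolic J]. *)
Definition retract J u : word V := [seq l <- u | l.1 \in J].

Lemma retract_el J u v : el u = el v -> el (retract J u) = el (retract J v).
Proof.
move=> /pres_classP; elim => //= {u v}.
- by move=> u v w _ -> _ ->.
- move=> u u' v v' _ IHu _ IHv.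
  by rewrite /retract !filter_cat !el_cat IHu IHv.
- move=> x b; rewrite /retract /=; case: (x \in J) => //.
  exact/pres_classP/pres_cancel.
- move=> u v [x y exy]; rewrite /retract /=.
  case: (x \in J); case: (y \in J) => //.
  exact/pres_classP/pres_rel/raag_commute.
Qed.

Lemma retract_id J u : all (fun l => l.1 \in J) u -> retract J u = u.
Proof. exact: all_filterP. Qed.

Lemma retract_parabolic J u : parabolic J (el u) -> el (retract J u) = el u.
Proof. by move=> [v vu vJ]; rewrite -(retract_el J vu) retract_id. Qed.

(** * Word length *)

Lemma len_subproof k : exists n, `[< exists2 u, el u = k & size u = n >].
Proof.
by exists (size (pres_repr k)); apply/asboolP; exists (pres_repr k); rewrite ?el_repr.
Qed.

Definition len k := ex_minn (len_subproof k).

Definition geod u := len (el u) == size u.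

Lemma len_el u : len (el u) <= size u.
Proof.
by rewrite /len; case: ex_minnP => n _; apply; apply/asboolP; exists u.
Qed.

Lemma geod_ex k : exists2 u, el u = k & geod u.
Proof.
suff [u uk un] : exists2 u, el u = k & size u = len k.
  by exists u; rewrite // /geod uk un.
by rewrite /len; case: ex_minnP => n /asboolP.
Qed.

Lemma len1 : len 1 = 0.
Proof. by apply/eqP; rewrite -leqn0; apply: (len_el [::]). Qed.

Lemma lenM k h : len (k * h) <= len k + len h.
Proof.
have [u <- /eqP ->] := geod_ex k; have [v <- /eqP ->] := geod_ex h.
by rewrite -el_cat -size_cat len_el.
Qed.

Lemma len_lt l : len (lt l) <= 1. Proof. exact: len_el. Qed.

Lemma lenV k : len k^-1 = len k.
Proof.
suff H h : len h^-1 <= len h.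
  by apply/eqP; rewrite eqn_leq H -{1}(invgK k) H.
have [u <- /eqP ->] := geod_ex h; rewrite -el_inv.
by apply: leq_trans (len_el _) _; rewrite size_rev size_map.
Qed.

Lemma geod_cat u v : geod (u ++ v) -> geod u /\ geod v.
Proof.
rewrite /geod el_cat size_cat => /eqP uv.
have := lenM (el u) (el v); have := len_el u; have := len_el v.
by split; lia.
Qed.

(** Deleting the letters outside [J] keeps the element, so it cannot shorten a geodesic word. *)
Lemma geod_retract J u : geod u -> parabolic J (el u) ->
  all (fun l => l.1 \in J) u.
Proof.
move=> /eqP ug uJ; rewrite all_count -size_filter.
rewrite eqn_leq size_filter count_size -size_filter.
have := len_el (retract J u).
by rewrite (retract_parabolic uJ) ug.
Qed.

Lemma parabolicI J K k : parabolic J k -> parabolic K k ->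
  parabolic [predI J & K] k.
Proof.
have [u <- ug] := geod_ex k => /(geod_retract ug) uJ /(geod_retract ug) uK.
apply: parabolic_el; rewrite (eq_all (a2 := predI (fun l => l.1 \in J) (fun l => l.1 \in K))) //.
by rewrite all_predI uJ uK.
Qed.

(** * Walls *)

Definition link x : {pred V} := [pred y | e x y].

(* The origin of the positively oriented edge underlying the edge (k, k * l). *)
Definition base k l := if l.2 then k else k * lt l.

(** The wall in question is that of the edge from 1 to [x]; its edges are the translates of this
    edge by [parabolic (link x)]. *)
Definition crosses x k l : bool :=
  (l.1 == x) && `[< parabolic (link x) (base k l) >].

Fixpoint parity x k u :=
  if u is l :: u' then crosses x k l (+) parity x (k * lt l) u' else false.

Lemma parity_cat x k u v :
  parity x k (u ++ v) = parity x k u (+) parity x (k * el u) v.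
Proof.
elim: u k => [|l u IHu] k /=; first by rewrite el_nil mulg1.
by rewrite IHu el_cons mulgA addbA.
Qed.

(** Opposite edges of a square with commuting labels are dual to the same wall. *)
Lemma crossesM x k l m : e m.1 l.1 -> crosses x (k * lt m) l = crosses x k l.
Proof.
rewrite /crosses; case: eqP => //= <- eml.
have mJ : parabolic (link l.1) (lt m).
  by apply: parabolic_el; rewrite /= andbT inE /= e_sym.
rewrite /base; case: l.2; first exact/asbool_equiv_eq/parabolicMr.
rewrite -mulgA lt_comm // mulgA; exact/asbool_equiv_eq/parabolicMr.
Qed.

(** A cancelling pair crosses one edge twice, and the two ways around a commuting square cross the
    same walls. *)
Lemma parity_el x k u v : el u = el v -> parity x k u = parity x k v.
Proof.
move=> uv; move: u v uv k.
suff H u v : pres_eq (raag_rel e) u v -> forall k, parity x k u = parity x k v.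
  by move=> u v /pres_classP/H.
elim => //= {u v}.
- by move=> u v w _ IH1 _ IH2 k; rewrite IH1 IH2.
- move=> u u' v v' uu' IHu _ IHv k.
  rewrite !parity_cat IHu IHv; congr (_ (+) parity _ (_ * _) _).
  exact/pres_classP.
- move=> y b k; rewrite addbF /crosses /= [X in X (+) _](_ : _ = (y == x) &&
    `[< parabolic (link x) (base (k * lt (y, b)) (y, ~~ b))>]) ?addbb //.
  by rewrite /base /=; case: b => //=; rewrite (lt_inv y true) mulgK.
- move=> u v [s t est] k /=; rewrite !addbF.
  rewrite (@crossesM x k (t, true) (s, true)) // (@crossesM x k (s, true) (t, true)) /=.
    by rewrite addbC.
  by rewrite e_sym.
Qed.

(* Crossing parities are compatible with the defining relations, so that walls are
   available without a normal form theorem.  A wall is represented by the halfspace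
   containing [g * x] but not [g]. *)
Definition halfspace x g : set G := [set k | parity x 1 (pres_repr (g^-1 * k))].

Definition wall c := exists x g, c = halfspace x g.

Lemma mem_halfspace x g u : (g * el u \in halfspace x g) = parity x 1 u.
Proof.
apply/idP/idP; rewrite in_setE /halfspace /= mulKg (@parity_el _ _ _ u) //;
  exact: el_repr.
Qed.

Lemma mem_halfspace' x g k u : el u = g^-1 * k ->
  (k \in halfspace x g) = parity x 1 u.
Proof. by move=> uE; rewrite -(mem_halfspace x g) uE mulVKg. Qed.

Lemma halfspace_step x g k l :
  (k * lt l \in halfspace x g) = (k \in halfspace x g) (+) crosses x (g^-1 * k) l.
Proof.
have [u uE _] := geod_ex (g^-1 * k).
rewrite (mem_halfspace' _ uE) (@mem_halfspace' _ _ _ (rcons u l)).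
  by rewrite -cats1 parity_cat uE mul1g /= addbF.
by rewrite el_rcons uE mulgA.
Qed.

Lemma link_irr x u : all (fun l => l.1 \in link x) u -> forall k, parity x k u = false.
Proof.
elim: u => //= l u IHu /andP[lx ux] k; rewrite IHu // addbF /crosses.
by case: eqP lx => //= ->; rewrite inE /= e_irr.
Qed.

Lemma crosses_shift x a k l : parabolic (link x) a ->
  crosses x (a * k) l = crosses x k l.
Proof.
move=> ax; rewrite /crosses; congr (_ && _); apply/asbool_equiv_eq.
by rewrite /base; case: l.2; rewrite -?mulgA; apply: parabolicMl.
Qed.

Lemma parity_shift x a k u : parabolic (link x) a ->
  parity x (a * k) u = parity x k u.
Proof.
move=> ax; elim: u k => //= l u IHu k.
by rewrite crosses_shift // -mulgA IHu.
Qed.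

Lemma halfspace_eq x g g' : parabolic (link x) (g^-1 * g') ->
  halfspace x g = halfspace x g'.
Proof.
move=> gg'; apply: eq_set_mem => k.
have [u uE _] := geod_ex (g'^-1 * k); rewrite (mem_halfspace' _ uE).
have [v vE vx] := gg'.
rewrite (@mem_halfspace' _ _ _ (v ++ u)); last by rewrite el_cat vE uE mulgA mulgK.
by rewrite parity_cat link_irr //= mul1g -(mulg1 (el v)) parity_shift // vE.
Qed.

Lemma halfspace_base x g : g \notin halfspace x g.
Proof. by rewrite (@mem_halfspace' _ _ _ [::]) // mulVg. Qed.

Lemma halfspace_top x g : g * lt (x, true) \in halfspace x g.
Proof.
rewrite halfspace_step (negbTE (halfspace_base _ _)) /= /crosses eqxx /=.
apply/asboolP; rewrite /base /= mulVg; exact: parabolic1.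
Qed.

(** The edge labelled [x] at [g] crosses the first wall, hence also the second, which determines
    label and coset. *)
Lemma halfspace_inj x g y h : halfspace x g = halfspace y h ->
  x = y /\ parabolic (link x) (g^-1 * h).
Proof.
move=> E; have := halfspace_top x g; have := halfspace_base x g.
rewrite E => gh; rewrite halfspace_step (negbTE gh) /=.
case/andP => /= /eqP -> /asboolP; rewrite /base /= => H; split=> //.
by rewrite -(invgK (_ * h)); apply: parabolicV; rewrite invgM invgK.
Qed.

(** Exclusive or makes separation additive along paths, as in [sepD]. *)
Definition sep c p q : bool := (p \in c) (+) (q \in c).

Lemma sep_sym c p q : sep c p q = sep c q p. Proof. exact: addbC. Qed.
Lemma sepp c p : sep c p p = false. Proof. exact: addbb. Qed.
Lemma sepD c p q r : sep c p r = sep c p q (+) sep c q r.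
Proof. by rewrite /sep addbA -(addbA (p \in c)) addbb addbF. Qed.

Definition dual k l := halfspace l.1 (base k l).

Lemma sep_step x g k l :
  sep (halfspace x g) k (k * lt l) = crosses x (g^-1 * k) l.
Proof. by rewrite /sep halfspace_step addbA addbb. Qed.

Lemma baseM g k l : base (g * k) l = g * base k l.
Proof. by rewrite /base; case: l.2 => //; rewrite mulgA. Qed.

Lemma sep_dual c k l : wall c -> sep c k (k * lt l) = (c == dual k l).
Proof.
move=> [x [g ->]]; rewrite sep_step; apply/idP/eqP.
  by case/andP=> /eqP lx /asboolP; rewrite baseM -lx; apply: halfspace_eq.
move/halfspace_inj => [xE H]; rewrite /crosses xE eqxx /=.
by apply/asboolP; rewrite baseM -xE.
Qed.

Lemma wall_dual k l : wall (dual k l). Proof. by exists l.1, (base k l). Qed.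

Fixpoint walls k u : seq (set G) :=
  if u is l :: u' then dual k l :: walls (k * lt l) u' else [::].

Lemma size_walls k u : size (walls k u) = size u.
Proof. by elim: u k => //= l u IHu k; rewrite IHu. Qed.

Lemma walls_cat k u v : walls k (u ++ v) = walls k u ++ walls (k * el u) v.
Proof.
by elim: u k => [|l u IHu] k /=; rewrite ?el_nil ?mulg1 // IHu el_cons mulgA.
Qed.

Lemma walls_wall k u c : c \in walls k u -> wall c.
Proof.
elim: u k => //= l u IHu k; rewrite inE => /orP[/eqP->|/IHu //].
exact: wall_dual.
Qed.

Lemma sep_walls c k u : wall c -> sep c k (k * el u) -> c \in walls k u.
Proof.
move=> cw; elim: u k => [|l u IHu] k /=; first by rewrite el_nil mulg1 sepp.
rewrite el_cons mulgA inE (sepD _ _ (k * lt l)) sep_dual //.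
by case: eqP => //= _; apply: IHu.
Qed.

Lemma walls_memP c k u : c \in walls k u ->
  exists u1 l u2, u = u1 ++ l :: u2 /\ c = dual (k * el u1) l.
Proof.
elim: u k => //= l u IHu k; rewrite inE => /orP[/eqP->|].
  by exists [::], l, u; rewrite el_nil mulg1.
move/IHu => [u1 [m [u2 [-> ->]]]]; exists (l :: u1), m, u2; split=> //.
by rewrite el_cons mulgA.
Qed.

Lemma link_lt x b a : parabolic (link x) a -> commute (lt (x, b)) a.
Proof.
apply: (@parabolic_comm (pred1 x)); first by move=> y z /eqP -> /=.
by apply: parabolic_el; rewrite /= inE eqxx.
Qed.

(** With equal signs, the label of [l] would occur in a geodesic word for an element of
    [parabolic (link l.1)], against irreflexivity. With opposite signs, [v] commutes with [l] and
    the end letters cancel. *)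
Lemma dual_cancel k l v m : geod (l :: v) -> geod (v ++ [:: m]) ->
  dual k l = dual (k * lt l * el v) m ->
  [/\ m = (l.1, ~~ l.2), parabolic (link l.1) (el v) &
      el (l :: v ++ [:: m]) = el v].
Proof.
move=> g1 g2 /halfspace_inj; case: l m g1 g2 => [x b] [y b'] /= g1 g2 [xy].
rewrite -{y}xy in g2 *.
have NJ u : (x, b) \in u \/ (x, b') \in u -> geod u -> parabolic (link x) (el u) -> False.
  move=> xu gu /(geod_retract gu)/allP H; case: xu => /H /=; by rewrite inE /= e_irr.
move: g1 g2 NJ; rewrite /base /= el_cons el_cat -/(lt _).
case: b b' => -[] /= g1 g2 NJ H.
- case: (NJ _ _ g1); first by left; rewrite inE eqxx.
  by move: H; rewrite -mulgA mulKg el_cons.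
- move: H; rewrite -!mulgA mulKg (lt_inv x true) => H.
  have E := commute_conj (link_lt true H).
  by rewrite !E in H *.
- move: H; rewrite mulKg => H; split=> //.
  by rewrite (lt_inv x true) -(link_lt true H) mulKg.
- case: (NJ _ _ g2); first by right; rewrite mem_cat inE eqxx orbT.
  by move: H; rewrite -(mulgA (k * _) (el v)) mulKg el_cat.
Qed.

Lemma geod_dual k l v m : geod (l :: v ++ [:: m]) ->
  dual k l != dual (k * lt l * el v) m.
Proof.
move=> gd; apply/eqP => /dual_cancel[||_ _ E].
- by case: (@geod_cat (l :: v) [:: m]).
- by case: (@geod_cat [:: l] (v ++ [:: m])).
- have := len_el v; rewrite -E (eqP gd) /= size_cat /=; lia.
Qed.

(** Two edges of one wall on a geodesic would cancel across the word between them. *)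
Lemma uniq_walls k u : geod u -> uniq (walls k u).
Proof.
elim: u k => //= l u IHu k gu; have [_ gu'] := @geod_cat [:: l] u gu.
rewrite IHu // andbT; apply/negP => /walls_memP[v [m [u2 [uE E]]]].
have : geod (l :: v ++ [:: m]).
  have := gu; rewrite uE -cat_rcons -cats1 -cat_cons => /geod_cat[]; done.
by move=> /(geod_dual k); rewrite -E eqxx.
Qed.

(** Since a geodesic crosses each wall at most once, the walls it crosses are those separating its
    ends. *)
Lemma geod_sep c k u : geod u -> wall c ->
  (c \in walls k u) = sep c k (k * el u).
Proof.
move=> gu cw; apply/idP/idP; last exact: sep_walls.
elim: u k gu => //= l u IHu k gu; have [_ gu'] := @geod_cat [:: l] u gu.
have /andP[n _] := uniq_walls k gu.
rewrite inE el_cons mulgA (sepD _ _ (k * lt l)) sep_dual //.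
case: eqP => [cE _|_ /=]; last exact: IHu.
apply/negP => /(sep_walls cw); rewrite cE; exact/negP.
Qed.

(** * Distances as numbers of separating walls *)

Definition dist p q := len (p^-1 * q).

Lemma distC p q : dist p q = dist q p.
Proof. by rewrite /dist -lenV invgM invgK. Qed.

Lemma distD p q r : dist p r <= dist p q + dist q r.
Proof. rewrite /dist (_ : p^-1 * r = p^-1 * q * (q^-1 * r)) ?lenM //.
by rewrite mulgA mulgK.
Qed.

Lemma distp p : dist p p = 0. Proof. by rewrite /dist mulVg len1. Qed.

Lemma geodesic p q : exists2 u, q = p * el u & geod u.
Proof.
by have [u uE gu] := geod_ex (p^-1 * q); exists u; rewrite // uE mulVKg.
Qed.

Lemma dist_geod k u : geod u -> dist k (k * el u) = size u.
Proof. by move=> /eqP gu; rewrite /dist mulKg. Qed.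

Lemma sep_walls_ex p q : exists2 s, uniq s /\ size s = dist p q &
  forall c, c \in s <-> wall c /\ sep c p q.
Proof.
have [u -> gu] := geodesic p q; exists (walls p u).
  by rewrite uniq_walls // size_walls dist_geod.
move=> c; split=> [cu|[cw]]; last by rewrite -geod_sep.
have cw := walls_wall cu; by rewrite -geod_sep.
Qed.

Lemma size_sep s p q : uniq s -> (forall c, c \in s -> wall c /\ sep c p q) ->
  size s <= dist p q.
Proof.
have [t [_ <-] tE] := sep_walls_ex p q => us sE.
by apply: uniq_leq_size => // c /sE /tE.
Qed.

Lemma sep_prefix c k u v : geod (u ++ v) -> wall c ->
  ~~ sep c k (k * el (u ++ v)) -> ~~ sep c k (k * el u).
Proof.
move=> guv cw n; have [gu gv] := geod_cat guv.
move: n; rewrite -!geod_sep // walls_cat mem_cat negb_or; by case/andP.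
Qed.

(** The coset of [w] by [parabolic (link l.1)] runs along the wall on the side of [w]. Every dual
    edge has an endpoint on it; which one depends on the orientation. *)
Lemma dual_endpoint z w l m : dual z m = dual w l ->
  parabolic (link l.1) (w^-1 * z) \/ parabolic (link l.1) (w^-1 * (z * lt m)).
Proof.
move/esym/halfspace_inj; case: l m => [x b] [y b'] /= [<-{y}].
have comm a : parabolic (link x) (lt (x, true) * (a * (lt (x, true))^-1)) ->
    parabolic (link x) a.
  by move=> H; rewrite -(commute_conj (link_lt true H)).
rewrite /base /=; case: b b' => -[] /=; try by [left|right].
- rewrite invgM (lt_inv x true) invgK -mulgA => H; right.
  by apply: comm; rewrite !mulgA mulgK -mulgA.
- rewrite invgM (lt_inv x true) invgK -mulgA => H; left.
  by apply: comm; rewrite -!mulgA.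
Qed.

Lemma crossing_point w l p u : geod u -> sep (dual w l) p (p * el u) ->
  exists u1 u2, u = u1 ++ u2 /\ parabolic (link l.1) (w^-1 * (p * el u1)).
Proof.
move=> gu; rewrite -geod_sep //; last exact: wall_dual.
case/walls_memP => [u1 [m [u2 [-> /esym/dual_endpoint[H|H]]]]].
  by exists u1, (m :: u2).
by exists (rcons u1 m), u2; rewrite cat_rcons el_rcons (mulgA p).
Qed.

Lemma link_nosep w l z : parabolic (link l.1) (w^-1 * z) -> ~~ sep (dual w l) w z.
Proof.
move=> [u uE ul]; have {uE} -> : z = w * el u by rewrite uE mulVKg.
apply/negP => /(sep_walls (wall_dual _ _))/walls_memP[u1 [m [u2 [uE]]]].
case/halfspace_inj => lm _; move: ul; rewrite uE all_cat /= lm.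
by case/and3P => _; rewrite inE /= e_irr.
Qed.

(* [c] is dual to an edge of the coset [g * parabolic J]. *)
Definition meets J g c :=
  exists a x, [/\ parabolic J a, x \in J & c = halfspace x (g * a)].

Lemma meets_wall J g c : meets J g c -> wall c.
Proof. by move=> [a [x [_ _ ->]]]; exists x, (g * a). Qed.

Lemma parabolic_lt J l : l.1 \in J -> parabolic J (lt l).
Proof. by move=> lJ; apply: parabolic_el; rewrite /= lJ. Qed.

Lemma sep_meets J g c p q : wall c -> parabolic J (g^-1 * p) ->
  parabolic J (g^-1 * q) -> sep c p q -> meets J g c.
Proof.
move=> cw Jp Jq.
have : parabolic J (p^-1 * q).
  have := parabolicM (parabolicV Jp) Jq.
  by rewrite invgM invgK mulgA mulgK.
move=> [u uE uJ]; have -> : q = p * el u by rewrite uE mulVKg.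
move/(sep_walls cw)/walls_memP => [u1 [l [u2 [{}uE ->]]]].
move: uJ; rewrite uE all_cat /= => /and3P[u1J lJ u2J].
exists (g^-1 * base (p * el u1) l), l.1; split=> //; last by rewrite mulVKg.
rewrite -baseM mulgA /base; case: l.2; last rewrite (parabolicMr _ (parabolic_lt lJ)).
  exact/parabolicM/parabolic_el.
exact/parabolicM/parabolic_el.
Qed.

Lemma meets_sep J g c : meets J g c -> exists p q,
  [/\ parabolic J (g^-1 * p), parabolic J (g^-1 * q) & sep c p q].
Proof.
move=> [a [x [aJ xJ ->]]]; exists (g * a), (g * a * lt (x, true)); split.
- by rewrite mulKg.
- by rewrite -mulgA mulKg; apply/parabolicM/parabolic_lt.
- by rewrite sep_dual //; exists x, (g * a).
Qed.

(** Geodesics across the wall of [(w, l)] pass through the coset of [w] along it. Two of them, on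
    different sides of [d], give points of this coset that [d] separates. *)
Lemma meets_link w l d p p' q q' : wall d ->
  ~~ sep (dual w l) w q -> ~~ sep (dual w l) w q' -> sep d q q' ->
  sep (dual w l) w p -> sep (dual w l) w p' -> sep d p p' ->
  meets (link l.1) w d.
Proof.
move=> dw nq nq' dqq' sp sp' dpp'.
(* Exchanging [p] and [p'] puts [q] and [p] on the same side of [d]. *)
wlog : p p' sp sp' dpp' / ~~ sep d q p.
  move=> H; case qp: (sep d q p); last by apply: H sp sp' dpp' _; rewrite qp.
  apply: H sp' sp _ _; first by rewrite sep_sym.
  by move: dpp'; rewrite (sepD _ _ q) (sep_sym d p q) qp /=.
move=> nqp; have nqp' : ~~ sep d q' p'.
  rewrite (sepD _ _ q) (sep_sym d q') dqq' (sepD _ _ p) dpp'.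
  by rewrite (negbTE nqp).
have pt r r' : ~~ sep (dual w l) w r -> sep (dual w l) w r' -> ~~ sep d r r' ->
    exists2 z, parabolic (link l.1) (w^-1 * z) & ~~ sep d r z.
  move=> nr; have [u -> gu] := geodesic r r' => sr' ndr.
  have : sep (dual w l) r (r * el u) by rewrite (sepD _ _ w) sep_sym (negbTE nr) sr'.
  case/(crossing_point gu) => [u1 [u2 [uE H]]]; exists (r * el u1) => //.
  by apply: (@sep_prefix d r u1 u2); rewrite -?uE.
have [z wz qz] := pt _ _ nq sp nqp; have [z' wz' qz'] := pt _ _ nq' sp' nqp'.
apply: (sep_meets dw wz wz').
rewrite (sepD _ _ q) (sepD _ q q') dqq' (negbTE qz') sep_sym (negbTE qz) //.
Qed.

Lemma min_coset (P : G -> Prop) k : (exists y : G, P y) ->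
  exists2 y : G, P y & forall z, P z -> dist y k <= dist z k.
Proof.
move=> exP; have exn : exists n, `[< exists2 y : G, P y & dist y k = n >].
  by have [y Py] := exP; exists (dist y k); apply/asboolP; exists y.
case: (ex_minnP exn) => n /asboolP[y Py yn] nmin; exists y => // z Pz.
by rewrite yn nmin //; apply/asboolP; exists z.
Qed.

(** The base points of the wall form a coset of [parabolic (link x)]. A shortest element of it lies
    in both parabolics, as retracting a geodesic word for it stays in the coset and cannot give a
    shorter element. *)
Lemma meetsI J K g c : meets J g c -> meets K g c -> meets [predI J & K] g c.
Proof.
move=> [a [x [aJ xJ ->]]] [b [y [bK yK]]].
move=> /halfspace_inj[xy]; rewrite -{y}xy in yK *.
rewrite invgM -mulgA mulKg => ab.
have [m am mmin] : exists2 m, parabolic (link x) (a^-1 * m) &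
    forall z, parabolic (link x) (a^-1 * z) -> dist m 1 <= dist z 1.
  by apply: min_coset; exists a; rewrite mulVg; apply: parabolic1.
have lenE z : dist z 1 = len z by rewrite /dist mulg1 lenV.
have inP L b' : parabolic L b' -> parabolic (link x) (a^-1 * b') -> parabolic L m.
  move=> [v vE vL] ab'; have [u um gu] := geod_ex m.
  have : parabolic (link x) (b'^-1 * m).
    have := parabolicM (parabolicV ab') am.
    by rewrite invgM invgK mulgA mulgK.
  move=> [r rE rx].
  have umE : el u = el (v ++ r) by rewrite el_cat vE rE mulVKg.
  have retE : el (retract L u) = b' * el (retract L r).
    by rewrite (retract_el L umE) /retract filter_cat el_cat (all_filterP vL) vE.
  have H : parabolic (link x) (a^-1 * el (retract L u)).
    rewrite retE mulgA; apply: parabolicM => //; apply: parabolic_el.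
    by rewrite all_filter; apply: sub_all rx => l /= ->; rewrite implybT.
  have := mmin _ H; rewrite !lenE -um (eqP gu) => le.
  apply: parabolic_el; rewrite all_count eqn_leq count_size -size_filter.
  exact: leq_trans le (len_el _).
exists m, x; split.
- by apply: parabolicI; [apply: inP aJ _; rewrite mulVg; apply: parabolic1|apply: inP bK _].
- by rewrite inE /= xJ.
- by apply: halfspace_eq; rewrite invgM -mulgA mulKg.
Qed.

Lemma meets_shift J g a c : parabolic J a -> meets J g c -> meets J (g * a) c.
Proof.
move=> aJ [b [x [bJ xJ ->]]]; exists (a^-1 * b), x; split=> //.
  exact: parabolicM (parabolicV aJ) bJ.
by rewrite -mulgA mulVKg.
Qed.

Lemma meets_parallel J K g b c : {in J & K, forall x y, e x y} ->
  parabolic K b -> meets J g c -> meets J (g * b) c.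
Proof.
move=> JK bK [a [x [aJ xJ ->]]]; exists a, x; split=> //.
rewrite -mulgA -(parabolic_comm JK aJ bK) mulgA; apply: halfspace_eq.
by rewrite mulKg; apply: parabolic_sub bK => y yK; apply: JK.
Qed.

(** * Gates *)

Definition gate J g k (y : G) := parabolic J (g^-1 * y) /\
  forall z, parabolic J (g^-1 * z) -> dist y k <= dist z k.

Lemma gate_ex J g k : exists y : G, gate J g k y.
Proof.
have [|y yJ ymin] := @min_coset (fun y : G => parabolic J (g^-1 * y)) k.
  by exists g; rewrite mulVg; apply: parabolic1.
by exists y.
Qed.

(** Otherwise a step along [l] stays in the coset and comes closer to [k]. *)
Lemma gate_letter J g k (y : G) l u : gate J g k y -> k = y * el (l :: u) ->
  geod (l :: u) -> l.1 \notin J.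
Proof.
move=> [yJ ymin] kE gu; apply/negP => lJ; rewrite kE in ymin.
have := ymin (y * lt l); rewrite dist_geod // el_cons (mulgA y _ (el u)) /dist mulKg => H.
have {}H : (size u).+1 <= len (el u).
  by apply: H; rewrite mulgA; apply: parabolicM => //; apply: parabolic_lt.
by have := leq_trans H (len_el u); rewrite ltnn.
Qed.

(** Induction along the geodesic from the gate: the letter of a first wall violating the claim would
    commute with all letters before it and could be moved to the front, against [gate_letter]. *)
Lemma gate_sep J g k (y : G) z c : gate J g k y -> wall c -> sep c y k ->
  parabolic J (g^-1 * z) -> ~~ sep c y z.
Proof.
move=> gy cw; have [u kE gu] := geodesic y k; rewrite {1}kE => /(sep_walls cw).
case/walls_memP => [u1 [l [u2 [uE ->]]]] {c cw}.
have [n] := ubnP (size u1); elim: n => // n IHn in u1 l u2 uE z *.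
rewrite ltnS => u1n zJ; apply/negP => /(sep_meets (wall_dual _ _) gy.1 zJ).
move=> [a [x [aJ xJ]]] /esym/halfspace_inj[xl H].
have [b bJ bu] : exists2 b, parabolic J (g^-1 * b) & parabolic (link x) (b^-1 * (y * el u1)).
  case: l xl H {uE} => l1 bl /= <-; rewrite /base /=; case: bl => H.
    by exists (g * a); rewrite ?mulKg.
  exists (g * a * lt (x, true)).
    by rewrite -mulgA mulKg; apply/parabolicM/parabolic_lt.
  move: H; rewrite (lt_inv x true) mulgA => H; rewrite invgM -mulgA.
  have := link_lt true H; rewrite /commute.
  move=> /(congr1 (fun t => (lt (x, true))^-1 * t)).
  by rewrite mulKg mulgVK => <-.
(* By induction the walls of [u1] do not separate [y] from [b], so they separate [b] from
   [y * el u1], two points that differ by an element of [parabolic (link x)]. *)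
have u1x : all (fun m => m.1 \in link x) u1.
  apply/allP => m mu1; case/splitPr: mu1 uE u1n bu => p1 p2 uE u1n bu.
  have bu' : sep (dual (y * el p1) m) b (y * el (p1 ++ m :: p2)).
    have gu1 : geod (p1 ++ m :: p2) by have := gu; rewrite uE => /geod_cat[].
    have p1n : size p1 < n by move: u1n; rewrite size_cat /=; lia.
    have /negbTE bn := IHn _ _ _ (etrans uE (esym (catA p1 (m :: p2) _))) _ p1n bJ.
    rewrite (sepD _ _ y) sep_sym bn -geod_sep //; last exact: wall_dual.
    by rewrite walls_cat mem_cat inE eqxx orbT.
  have := sep_meets (wall_dual _ _) _ bu bu'; rewrite mulVg => /(_ (parabolic1 _)).
  by move=> [a' [x' [_ x'x]]] /halfspace_inj[-> _].
have := @gate_letter _ _ _ _ l (u1 ++ u2) gy.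
have E : el (l :: u1 ++ u2) = el u.
  rewrite uE el_cons !el_cat el_cons !mulgA; congr (_ * _).
  case: l xl {H uE} => l1 bl /= <-; apply: (link_lt bl).
  exact: parabolic_el.
rewrite E kE -xl xJ => nJ; apply/notF/nJ => //.
by rewrite /geod E (eqP gu) uE /= !size_cat /= addnS.
Qed.

(** * First letters of geodesics and cancellation in words *)

Lemma base_comm k l m : e m.1 l.1 -> base (k * lt m) l = base k l * lt m.
Proof. by move=> eml; rewrite /base; case: l.2 => //; rewrite -!mulgA lt_comm. Qed.

Lemma dual_inv k l : dual (k * lt l) (l.1, ~~ l.2) = dual k l.
Proof.
rewrite /dual /base; case: l => x [] //=.
by rewrite (lt_inv x true) mulgK.
Qed.

(** A geodesic from [w * lt l] to [p] passes through the coset of [w] along the wall of [m]. The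
    wall of [l] separates two points of this coset, so its label is in [link m.1]. *)
Lemma adjacent_halfspaces w l m p : sep (dual w l) w p -> sep (dual w m) w p ->
  dual w l != dual w m -> e l.1 m.1.
Proof.
move=> lp mp lm; have [u pE gu] := geodesic (w * lt l) p.
have mw : sep (dual w m) (w * lt l) p.
  rewrite (sepD _ _ w) sep_sym sep_dual; last exact: wall_dual.
  by rewrite eq_sym (negbTE lm) mp.
move: (mw); rewrite {1}pE => /(crossing_point gu)[u1 [u2 [uE H]]].
have : ~~ sep (dual w l) (w * lt l) (w * lt l * el u1).
  apply: (@sep_prefix _ _ u1 u2); rewrite -?uE //; first exact: wall_dual.
  rewrite -pE (sepD _ _ w) sep_sym sep_dual ?eqxx ?lp //; exact: wall_dual.
move=> nl; have := @sep_meets (link m.1) w (dual w l) w (w * lt l * el u1).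
rewrite mulVg => /(_ (wall_dual _ _) (parabolic1 _) H) [|a [x [_ xm]]].
  by rewrite (sepD _ _ (w * lt l)) sep_dual ?eqxx ?(negbTE nl) //; exact: wall_dual.
by case/halfspace_inj => -> _; rewrite e_sym.
Qed.

(** Some first wall shields [c]. By induction [l] shields [c] after the letter [s]; it is moved to
    the front if it commutes with [s], and otherwise [s] shields [l]. *)
Lemma first_wall c k u : geod u -> wall c -> sep c k (k * el u) ->
  exists l u', [/\ el u = el (l :: u'), geod (l :: u') &
    forall p, sep c k p -> sep (dual k l) k p].
Proof.
move=> gu cw; elim: u k gu => [|s u IHu] k gu; first by rewrite el_nil mulg1 sepp.
have [_ gu'] := @geod_cat [:: s] u gu.
case: (c =P dual k s) => [-> _|/eqP cs]; first by exists s, u.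
have ncs : sep c k (k * lt s) = false by rewrite sep_dual // (negbTE cs).
rewrite el_cons mulgA (sepD _ _ (k * lt s)) ncs /=.
move=> /(IHu _ gu')[l [u' [uE gl lP]]].
have sE : size u = (size u').+1 by rewrite -(eqP gu') uE (eqP gl).
have uE' : el (s :: u) = el (s :: l :: u') by rewrite !el_cons uE el_cons.
have gsl : geod (s :: l :: u') by rewrite /geod -uE' (eqP gu) /= sE.
have uq : dual k s != dual (k * lt s) l.
  have := uniq_walls k gsl; rewrite /= inE negb_or -andbA; by case/and3P.
case esl: (e s.1 l.1).
  have lsk : dual (k * lt s) l = dual k l.
    by apply: halfspace_eq; rewrite base_comm // invgM -mulgA mulVg mulg1;
      apply/parabolicV/parabolic_lt; rewrite inE /= e_sym.
  exists l, (s :: u'); rewrite uE !el_cons !mulgA (lt_comm esl); split=> //.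
    by move: gsl; rewrite /geod !el_cons !mulgA (lt_comm esl).
  move=> p; rewrite (sepD _ _ (k * lt s)) ncs /= => /lP; rewrite lsk => H.
  rewrite (sepD _ _ (k * lt s)) H sep_dual; last exact: wall_dual.
  by rewrite -lsk eq_sym (negbTE uq).
exists s, u; rewrite el_cons; split=> // p; rewrite (sepD _ _ (k * lt s)) ncs /= => /lP H.
rewrite (sepD _ _ (k * lt s)) sep_dual ?eqxx /=; last exact: wall_dual.
(* Seen from [k * lt s], a point beyond the wall of [l] on the side of [k] would lie beyond two
   walls at this vertex, forcing their labels to be adjacent. *)
apply/negP; rewrite -dual_inv => H'.
have := adjacent_halfspaces H H'; rewrite dual_inv eq_sym uq => /(_ isT) /=.
by rewrite e_sym esl.
Qed.

(** A wall crossed exactly once separates the ends, so the distance is at least the length of the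
    word. *)
Lemma uniq_geod k u : uniq (walls k u) -> geod u.
Proof.
move=> uu; rewrite /geod eqn_leq len_el /=.
rewrite -(size_walls k u) -(mulKg k (el u)); apply: size_sep => // c cu.
have cw := walls_wall cu; split=> //.
have [u1 [l [u2 [uE cE]]]] := walls_memP cu.
move: uu; rewrite uE walls_cat /= cat_uniq /= -cE negb_or.
case/and3P => _ /andP[c1 _] /andP[c2 _].
rewrite el_cat el_cons !mulgA (sepD _ k (k * el u1)) (sepD _ (k * el u1) (k * el u1 * lt l)).
rewrite (sep_dual (k * el u1) l cw) -cE eqxx.
case: (boolP (sep c k _)) c1 => [/(sep_walls cw) ->//|_ _].
by case: (boolP (sep c _ _)) c2 => [/(sep_walls cw) ->|].
Qed.

(** In a shortest non-geodesic suffix the wall of the first letter is crossed again, and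
    [dual_cancel] applies to the two edges. *)
Lemma geodN u : ~~ geod u -> exists u1 l v u2,
  u = u1 ++ l :: v ++ (l.1, ~~ l.2) :: u2 /\ all (fun m => m.1 \in link l.1) v.
Proof.
elim: u => [|l u IHu]; first by rewrite /geod el_nil len1.
case: (boolP (geod u)) => [gu|/IHu [u1 [m [v [u2 [-> vm]]]]] _]; last first.
  by exists (l :: u1), m, v, u2.
move=> ng; have : dual 1 l \in walls (1 * lt l) u.
  apply: contraNT ng => nl; apply: (@uniq_geod 1); rewrite /= nl /=.
  exact: uniq_walls.
case/walls_memP => [v [m [u2 [uE E]]]].
have gvm : geod (v ++ [:: m]).
  by have := gu; rewrite uE -cat_rcons -cats1 => /geod_cat[].
have [gv _] := geod_cat gvm.
have glv : geod (l :: v).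
  apply: (@uniq_geod 1); rewrite /= uniq_walls // andbT E.
  have := uniq_walls (1 * lt l) gvm; rewrite walls_cat cat_uniq /= orbF.
  by case/and3P.
have [mE /(geod_retract gv) vl _] := dual_cancel glv gvm E.
by exists [::], l, v, u2; rewrite uE mE.
Qed.

(** * Torsion-freeness *)

Lemma flatten_nseq_rot (T : Type) n (a b : seq T) :
  flatten (nseq n.+1 (a ++ b)) = a ++ flatten (nseq n (b ++ a)) ++ b.
Proof. by elim: n => [|n /= IHn]; rewrite /= ?cats0 // IHn !catA. Qed.

Lemma flatten_nseq_suffix (T : eqType) n (u p s : seq T) :
  flatten (nseq n u) = p ++ s -> 0 < size s ->
  exists i b t, i <= size u /\ flatten (nseq b (rot i u)) = s ++ t.
Proof.
elim: n p => [|n IHn] p /=; first by case: p; case: s.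
have [pu|up] := leqP (size u) (size p).
  have -> : p = take (size u) p ++ drop (size u) p by rewrite cat_take_drop.
  rewrite -catA => /eqP; rewrite eqseq_cat ?size_takel // => /andP[_ /eqP].
  exact: IHn.
move=> E _; exists (size p), n.+1, p; split; first exact: ltnW.
have uE : u = p ++ drop (size p) u.
  rewrite -{1}(cat_take_drop (size p) u); congr (_ ++ _).
  by move/(congr1 (take (size p))): E; rewrite take_cat up take_size_cat.
rewrite /rot [take _ _](_ : _ = p); last by rewrite uE take_size_cat.
rewrite flatten_nseq_rot -uE catA; congr (_ ++ _).
move: E; rewrite {1}uE -catA => /eqP.
by rewrite eqseq_cat // => /andP[_ /eqP].
Qed.
Lemma el_flatten n u : el (flatten (nseq n u)) = el u ^+ n.
Proof. by elim: n => //= n IHn; rewrite el_cat IHn expgS. Qed.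

Lemma conj_expg g k n : (g^-1 * k * g) ^+ n = g^-1 * k ^+ n * g.
Proof.
elim: n => [|n IHn]; first by rewrite !expg0 mulg1 mulVg.
by rewrite !expgS IHn !mulgA mulgK.
Qed.

(** Let [u] represent a shortest conjugate. A cancelling pair in a power of [u] fits into one
    rotation of [u]; cancelling it would give a shorter conjugate. *)
Lemma torsion_free k n : 0 < n -> k ^+ n = 1 -> k = 1.
Proof.
move=> n0 kn.
have exn : exists j : nat, `[< exists g, len (g^-1 * k * g) = j >].
  by exists (len (1^-1 * k * 1)); apply/asboolP; exists 1.
case: (ex_minnP exn) => j /asboolP[g gm] mmin.
have [u uE gu] := geod_ex (g^-1 * k * g).
have mE : j = size u by rewrite -gm -uE (eqP gu).
have [u0|u_gt0] := posnP (size u).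
  move: uE; rewrite (size0nil u0) el_nil => /(congr1 (fun z => g * z * g^-1)).
  by rewrite mulg1 mulgV -!mulgA mulgV mulg1 mulVKg.
have : ~~ geod (flatten (nseq n u)).
  rewrite /geod el_flatten uE conj_expg kn mulg1 mulVg len1 eq_sym.
  by rewrite -lt0n; case: n n0 {kn} => //= n' _; rewrite size_cat addn_gt0 u_gt0.
case/geodN => [u1 [l [v [u2 [/flatten_nseq_suffix E vl]]]]].
case: (E isT) => i [b [t [_]]] {E}; set U := rot i u.
have UL : size U = size u by rewrite size_rot.
have Umin : size u <= len (el U).
  rewrite -mE; apply: mmin; apply/asboolP; exists (g * el (take i u)).
  have -> : el U = (el (take i u))^-1 * el u * el (take i u).
    have -> : el u = el (take i u) * el (drop i u) by rewrite -el_cat cat_take_drop.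
    rewrite mulKg.
    by rewrite /U /rot el_cat.
  by rewrite uE invgM !mulgA.
case: b => //= b E.
have nl : l \notin v ++ [:: (l.1, ~~ l.2)].
  rewrite mem_cat inE negb_or; apply/andP; split; last first.
    by case: (l) => x c; rewrite xpair_eqE negb_and /=; case: c; rewrite orbT.
  by apply/negP => /(allP vl); rewrite inE /= e_irr.
(* Otherwise the copy of [l] one period later would lie in [v] or be the inverse letter. *)
have sv : (size v).+1 < size u.
  rewrite ltnNge; apply/negP => le.
  have U0 : nth l U 0 = l.
    by move/(congr1 (fun s => nth l s 0)): E; rewrite nth_cat UL u_gt0.
  have lin : nth l (l :: (v ++ (l.1, ~~ l.2) :: u2) ++ t) (size u) \in
      v ++ [:: (l.1, ~~ l.2)].
    case: (size u) u_gt0 le => // L _ le.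
    by rewrite /= -cat_rcons -catA cats1 nth_cat size_rcons le mem_nth ?size_rcons.
  have := congr1 (fun s => nth l s (size u)) E.
  rewrite nth_cat UL ltnn subnn.
  case: b E => [|b] E.
    have := congr1 size E; rewrite /= cats0 UL !size_cat /= => HH.
    have : forall i1 i2 i3 i4 : nat, i4 <= i1.+1 -> i4 = (i1 + i2.+1 + i3).+1 -> False by lia.
    by move/(_ _ _ _ _ le HH).
  rewrite [X in X = _](_ : _ = l); last by rewrite /= nth_cat UL u_gt0.
  by move=> lE; move/negP: nl; apply; rewrite {1}lE.
pose s := l :: v ++ [:: (l.1, ~~ l.2)].
have ss : size s = (size v).+2 by rewrite /= size_cat addn1.
have UE : U = s ++ drop (size s) U.
  rewrite -{1}(cat_take_drop (size s) U); congr (_ ++ _).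
  have : U ++ flatten (nseq b U) = s ++ (u2 ++ t) by rewrite E /s /= -!catA.
  move/(congr1 (take (size s))); rewrite (take_size_cat _ (erefl (size s))) => E2.
  by rewrite -[RHS]E2 takel_cat // ss UL.
have sE : el s = el v.
  rewrite /s el_cons el_cat; case: (l) vl => x c /= vl.
  by rewrite -/(lt _) -(link_lt (~~ c) (parabolic_el vl)) mulgA lt_inv mulgV mul1g.
have := len_el (v ++ drop (size s) U); rewrite el_cat -sE -el_cat -UE.
move/(leq_trans Umin); rewrite size_cat size_drop UL ss; lia.
Qed.

Lemma el_nseq n l : el (nseq n l) = lt l ^+ n.
Proof. by elim: n => //= n IHn; rewrite expgS -IHn el_cons. Qed.

Lemma geod_nseq n l : geod (nseq n l).
Proof.
apply/contraT => /geodN[u1 [m [v [u2 [E _]]]]].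
have : all (pred1 l) (nseq n l) by apply/allP => z; rewrite mem_nseq => /andP[].
rewrite E all_cat /= all_cat /= => /and5P[_ /eqP <- _ /eqP].
by case: m {E} => x [].
Qed.

Lemma expg_len l n : len (lt l ^+ n) = n.
Proof. by rewrite -el_nseq (eqP (geod_nseq n l)) size_nseq. Qed.

(** * Purely loxodromic subgroups *)

Definition perp J : {pred V} := [pred y | [forall x in J, e x y]].

Lemma perpP J : {in J & perp J, forall x y, e x y}.
Proof. by move=> x y xJ /forall_inP; apply. Qed.

Lemma parabolicU J K k : {in J & K, forall x y, e x y} ->
  parabolic [predU J & K] k ->
  exists a b, [/\ parabolic J a, parabolic K b & k = a * b].
Proof.
move=> JK [u <-]; elim: u => [_|l u IHu /= /andP[lJK /IHu[a [b [aJ bK E]]]]].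
  by exists 1, 1; split; rewrite ?mulg1 //; apply: parabolic1.
rewrite el_cons E; case/orP: lJK => [lJ|lK].
  exists (lt l * a), b; split=> //; last by rewrite mulgA.
  by apply: parabolicM => //; apply: parabolic_lt.
exists a, (lt l * b); split=> //.
  by apply: parabolicM => //; apply: parabolic_lt.
by rewrite !mulgA (parabolic_comm JK aJ (parabolic_lt lK)).
Qed.

Definition ball n : seq G :=
  flatten [seq [seq el (val t) | t : i.-tuple (V * bool)] | i <- iota 0 n.+1].

Lemma mem_ball n k : len k <= n -> k \in ball n.
Proof.
have [u <- /eqP ->] := geod_ex k => un.
apply/flattenP; exists [seq el (val t) | t : (size u).-tuple (V * bool)].
  by apply/mapP; exists (size u); rewrite // mem_iota.
by apply/mapP; exists (in_tuple u); rewrite ?mem_enum.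
Qed.

Lemma sep_base c p q : wall c -> sep c p q ->
  exists x b, len b <= dist p q /\ c = halfspace x (p * b).
Proof.
move=> cw; have [u -> gu] := geodesic p q => /(sep_walls cw)/walls_memP.
move=> [u1 [l [u2 [uE ->]]]]; exists l.1, (base (el u1) l).
rewrite dist_geod // -baseM; split=> //; rewrite /base; case: l.2.
  by rewrite (leq_trans (len_el u1)) // uE size_cat leq_addr.
rewrite -el_rcons (leq_trans (len_el _)) // uE size_rcons size_cat /=; lia.
Qed.

Section Loxodromic.
Variables (H : set G) (Fl : G -> nat) (L : nat).

(* [Fl] is the word length of [H] for a finite generating set. *)
Definition Hgeodesic n (p : nat -> G) := forall i j, i <= j <= n ->
  [/\ H (p i), H (p j), H ((p i)^-1 * p j) & Fl ((p i)^-1 * p j) = j - i].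

(** Both factors of the join have to be nonempty; otherwise [J] could be the whole vertex set, which
    would force [H] to be trivial. *)
Definition loxodromic := forall J g k, (exists x, x \in J) ->
  (exists y, y \in perp J) -> H k ->
  parabolic [predU J & perp J] (g^-1 * k * g) -> k = 1.

Hypothesis Hlox : loxodromic.
Hypothesis HL : forall k, H k -> Fl k <= 1 -> len k <= L.
Hypothesis HM : forall k h, H k -> H h -> H (k * h^-1).

Lemma Hstep n (p : nat -> G) i : Hgeodesic n p -> i < n -> dist (p i) (p i.+1) <= L.
Proof.
move=> hp ni; have [|_ _ Hk Flk] := hp i i.+1; first lia.
by apply: HL => //; rewrite Flk; lia.
Qed.

(** A nonempty link of [x] lies in the join of [x] and its link; the parabolic of an empty link is
    trivial. *)
Lemma stabilizer_trivial x g k : H k -> parabolic (link x) (g^-1 * k * g) -> k = 1.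
Proof.
move=> Hk kx; case: (pselect (exists y, y \in link x)) => [xy|nx]; last first.
  have [u uE ux] := kx; suff u0 : u = [::].
    move: uE; rewrite u0 el_nil => /(congr1 (fun z => g * z * g^-1)).
    by rewrite mulg1 mulgV -!mulgA mulgV mulg1 mulVKg.
  by case: u ux {uE} => //= l u /andP[lx _]; case: nx; exists l.1.
have sub : {subset link x <= perp (pred1 x)}.
  by move=> y xy'; apply/forall_inP => z /eqP ->.
apply: (@Hlox (pred1 x) g) => //.
- by exists x; rewrite inE.
- by have [y /sub] := xy; exists y.
- by apply: parabolic_sub kx => y /sub; rewrite !inE orbC => ->.
Qed.

(** Two steps across a wall labelled [x] yield [k] in [H] and short [b], [b'] with b^-1 k b' in the
    parabolic of the link. Given [b], [b'] and [x] there is at most one such [k], since wall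
    stabilizers meet [H] trivially; [D] bounds these finitely many lengths. *)
Lemma wall_steps_bounded : exists D, forall n (p : nat -> G) c i j, Hgeodesic n p -> wall c ->
  i <= j -> j < n -> sep c (p i) (p i.+1) -> sep c (p j) (p j.+1) -> j <= i + D.
Proof.
pose s := [seq (bb, x) | bb <- [seq (b, b') | b <- ball L, b' <- ball L], x <- enum V].
pose P (t : (G * G) * V) D := forall k, H k ->
  parabolic (link t.2) (t.1.1^-1 * (k * t.1.2)) -> Fl k <= D.
have [|[[b b'] x] _|D DP] := @bounded_seq _ s P.
- by move=> t m n mn Pm k Hk /(Pm k Hk)/leq_trans; apply.
- case: (pselect (exists2 k, H k & parabolic (link x) (b^-1 * (k * b')))).
    move=> [k Hk kx]; exists (Fl k) => h Hh /= hx.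
    suff -> : h = k by [].
    apply: divg1_eq; apply: (@stabilizer_trivial x b); first exact: HM.
    have := parabolicM hx (parabolicV kx).
    by rewrite !invgM invgK -!mulgA mulVKg.
  by move=> n; exists 0 => k Hk kx; case: n; exists k.
exists D => n p c i j hp cw ij jn si sj.
have [x [b [bL cE]]] := sep_base cw si; have [y [b' [bL' cE']]] := sep_base cw sj.
have ni : i < n by lia.
have [|_ _ Hk Flk] := hp i j; first lia.
move: cE'; rewrite cE => /halfspace_inj[xy kx].
have := DP (b, b', x) _ _ Hk; rewrite /= Flk leq_subLR; apply.
  apply/allpairsP; exists ((b, b'), x); rewrite mem_enum; split=> //.
  apply/allpairsP; exists (b, b'); split=> //.
    by apply: mem_ball; apply: leq_trans bL (Hstep hp ni).
  by apply: mem_ball; apply: leq_trans bL' (Hstep hp jn).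
by move: kx; rewrite invgM -!mulgA.
Qed.

Lemma nosep_steps c (p : nat -> G) i j : (forall t, i <= t < j -> ~~ sep c (p t) (p t.+1)) ->
  i <= j -> ~~ sep c (p i) (p j).
Proof.
elim: j => [|j IHj] st ij; first by rewrite (_ : i = 0) ?sepp //; lia.
move: ij; rewrite leq_eqVlt => /orP[/eqP ->|]; first by rewrite sepp.
rewrite ltnS => ij; rewrite (sepD _ _ (p j)) (negbTE (IHj _ _)) //=.
  by apply: st; rewrite ij /=.
by move=> t tj; apply: st; lia.
Qed.

Definition crossing_steps J g n (p : nat -> G) : {pred 'I_n} :=
  [pred i : 'I_n | `[< exists2 c, meets J g c & sep c (p i) (p i.+1) >]].

Arguments crossing_steps : clear implicits.

(** Each step crosses at most [L] walls, so the steps in [T] cannot account for all walls between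
    [q] and [r]. *)
Lemma avoiding_wall n (p : nat -> G) (T : seq nat) q r : Hgeodesic n p ->
  size T * L < dist q r ->
  exists c, [/\ wall c, sep c q r &
    forall t, t \in T -> t < n -> ~~ sep c (p t) (p t.+1)].
Proof.
move=> hp big.
have /choice[f fP] : forall t, exists s : seq (set G), t < n ->
    size s <= L /\ forall c, wall c -> sep c (p t) (p t.+1) -> c \in s.
  move=> t; have [s [_ sE] sP] := sep_walls_ex (p t) (p t.+1).
  exists s => tn; rewrite sE (Hstep hp tn); split=> // c cw cs.
  exact/sP.
have [s [us sE] sP] := sep_walls_ex q r.
pose bad := flatten [seq f t | t <- [seq t <- T | t < n]].
have badN : size bad <= size T * L.
  apply: leq_trans (size_flatten_map (N := L) _) _.
    by move=> t; rewrite mem_filter => /andP[/fP[]].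
  by rewrite leq_mul2r size_filter count_size orbT.
case: (pselect (exists2 c, c \in s & c \notin bad)) => [[c /sP[cw cs] cb]|nb].
  exists c; split=> // t tT tn; apply: contra cb => ct.
  apply/flattenP; exists (f t); last exact: (fP _ tn).2.
  by apply: map_f; rewrite mem_filter tn.
have : size s <= size bad.
  apply: uniq_leq_size => // c cs; apply: contrapT => /negP cb.
  by apply: nb; exists c.
by rewrite sE => /leq_trans/(_ badN); rewrite leqNgt big.
Qed.

Definition steps_bound D := forall n (p : nat -> G) c i j, Hgeodesic n p ->
  wall c -> i <= j -> j < n -> sep c (p i) (p i.+1) -> sep c (p j) (p j.+1) ->
  j <= i + D.

(** A wall avoiding the 2D + 1 steps around [i] is not crossed both before and after [i]: these
    crossings would be more than [D] apart. *)
Lemma far_wall D n (p : nat -> G) i q : steps_bound D -> Hgeodesic n p ->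
  i <= n -> D.*2.+1 * L < dist q (p i) ->
  exists c, [/\ wall c, sep c q (p i) &
    (forall j, i <= j <= n -> ~~ sep c (p i) (p j)) \/
    (forall j, j <= i -> ~~ sep c (p i) (p j))].
Proof.
move=> hD hp ni far.
have [|c [cw cs cT]] := @avoiding_wall n p (iota (i - D) D.*2.+1) q (p i) hp.
  by rewrite size_iota.
exists c; split=> //.
have {}cT t : i - D <= t <= i + D -> t < n -> ~~ sep c (p t) (p t.+1).
  by move=> ti; apply: cT; rewrite mem_iota; lia.
case: (pselect (exists2 t, i <= t < n & sep c (p t) (p t.+1))) => [[t ti st]|ns].
  right=> j ji; rewrite sep_sym; apply: nosep_steps => // t' jt'.
  apply/negP => st'; have := @hD n p c t' t hp cw _ _ st' st.
  have : i + D < t.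
    by rewrite ltnNge; apply/negP => tD; move: st; apply/negP/cT; lia.
  lia.
left=> j ij; apply: nosep_steps => [t tj|]; last lia.
by apply/negP => st; apply: ns; exists t => //; lia.
Qed.

(** Induction on the size of [J]. Steps close to their gates on the coset of the join are few, as
    [H] meets its conjugates trivially. Another step is shielded from its gate by a wall not crossed
    later, or not crossed earlier, and the steps on that side are counted by a smaller set. *)
Lemma crossing_steps_bounded (m : nat) : exists N, forall J, #|J| <= m ->
  (exists y, y \in perp J) -> forall g n (p : nat -> G), Hgeodesic n p ->
  #|crossing_steps J g n p| <= N.
Proof.
elim: m => [|m [N IHN]].
  exists 0 => J J0 _ g n p _; rewrite leqn0; apply/pred0P => i /=.
  apply/negP => /asboolP[c [a [x [_ xJ _]]] _].
  by move: J0; rewrite leqn0 => /eqP/card0_eq/(_ x); rewrite xJ.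
have [D hD] := wall_steps_bounded; set B := (D.*2.+1 * L)%N.
exists (size (ball B) + (N + N.+1)) => J Jm Jperp g n p hp.
case: (pselect (exists x, x \in J)) => [xJ|nJ]; last first.
  rewrite (@eq_card0 _ (crossing_steps _ _ _ _)) // => i.
  apply/negP => /asboolP[c [a [x [_ xJ _]]] _]; by apply: nJ; exists x.
pose JJ : {pred V} := [predU J & perp J].
have /choice[y yP] : forall i, exists z, gate JJ g (p i) z.
  by move=> i; apply: gate_ex.
(* Beyond a far wall, all crossing walls also cross the coset of a smaller set of
   generators. *)
have shield i c : wall c -> sep c (y i) (p i) -> exists J' g',
    [/\ #|J'| <= m, exists x, x \in perp J' & forall j : 'I_n,
     j \in crossing_steps J g n p -> ~~ sep c (p i) (p j) ->
     ~~ sep c (p i) (p j.+1) -> j \in crossing_steps J' g' n p].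
  move=> cw cs; have [u pE gu] := geodesic (y i) (p i).
  move: (cs); rewrite {1}pE => /(first_wall gu cw)[l [u' [uE gl lP]]].
  have lJJ : l.1 \notin JJ by apply: gate_letter (yP i) _ gl; rewrite -uE.
  exists ([predI J & link l.1] : {pred V}), (y i); split.
  (* As [l] lies outside [perp J], some vertex of [J] is not adjacent to it. *)
  - have : l.1 \notin perp J by apply: contra lJJ => H'; apply/orP; right.
    case/forall_inPn => x xJ' nx.
    rewrite -ltnS; apply: leq_trans Jm; apply: proper_card.
    apply/properP; split; first by apply/fintype.subsetP => z /andP[].
    by exists x; rewrite // inE /= xJ' inE /= e_sym.
  - have [z /forall_inP zJ] := Jperp; exists z; apply/forall_inP => x.
    by case/andP => /zJ.
  move=> j /asboolP[c' c'J sj] n1 n2; apply/asboolP; exists c' => //.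
  (* The [perp J] component of the gate moves the coset parallel to itself, along the same walls. *)
  have [gyJ _] := yP i; have [a [b [aJ bJ gyE]]] := parabolicU (@perpP J) gyJ.
  have {}c'J : meets J (y i) c'.
    rewrite -(mulVKg g (y i)) gyE mulgA.
    exact: meets_parallel (@perpP J) bJ (meets_shift aJ c'J).
  apply: meetsI => //.
  have [q [q' [qJ q'J sq]]] := meets_sep c'J.
  (* The wall of [l] at the gate has the coset on one side and the points beyond [c] on the other;
     [c'] separates points on both sides. *)
  have far r : ~~ sep c (p i) r -> sep (dual (y i) l) (y i) r.
    by move=> nr; apply: lP; rewrite (sepD _ _ (p i)) (negbTE nr) addbF.
  have near r : parabolic J ((y i)^-1 * r) -> ~~ sep (dual (y i) l) (y i) r.
    move=> rJ; apply: (gate_sep (yP i)); first exact: wall_dual.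
      by apply: far; rewrite sepp.
    rewrite -(mulVKg (y i) r) mulgA; apply: parabolicM => //.
    by apply: parabolic_sub rJ => z zJ; rewrite !inE zJ.
  apply: (@meets_link (y i) l c' (p j) (p j.+1) q q') => //.
  - exact: meets_wall c'J.
  - exact: near.
  - exact: near.
  - exact: far.
  - exact: far.
pose C := crossing_steps J g n p.
pose near := [pred j : 'I_n | (j \in C) && (dist (y j) (p j) <= B)].
pose fw := [pred j : 'I_n | (j \in C) && `[< exists c, [/\ wall c,
  sep c (y j) (p j) & forall t, j <= t <= n -> ~~ sep c (p j) (p t)] >]].
pose bw := [pred j : 'I_n | (j \in C) && `[< exists c, [/\ wall c,
  sep c (y j) (p j) & forall t, t <= j -> ~~ sep c (p j) (p t)] >]].
have sub : {subset C <= [predU near & [predU fw & bw]]}.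
  move=> j jC; apply/orP; case: (leqP (dist (y j) (p j)) B) => far.
    by left; apply/andP.
  have [|c [cw cs [cf|cb]]] := far_wall hD hp _ far; first exact/ltnW/ltn_ord.
    by right; apply/orP; left; apply/andP; split=> //; apply/asboolP; exists c.
  by right; apply/orP; right; apply/andP; split=> //; apply/asboolP; exists c.
have /leq_trans -> // : #|C| <= #|near| + (#|fw| + #|bw|).
  apply: leq_trans (subset_leq_card (introT fintype.subsetP sub)) _.
  by apply: leq_trans (cardU_le _ _) _; rewrite leq_add2l cardU_le.
apply: leq_add; last apply: leq_add.
- pose r (j : 'I_n) := (y j)^-1 * p j.
  (* Equal displacements from two gates would give a nontrivial element of [H] in a conjugate of the
     join subgroup. *)
  have rinj i j : i < j -> j < n -> (y i)^-1 * p i <> (y j)^-1 * p j.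
    move=> ij jn E; have [|Hi Hj _ Fij] := hp i j; first lia.
    have : p j * (p i)^-1 = 1.
      apply: (@Hlox J g) => //; first exact: HM.
      have <- : (g^-1 * y j) * (g^-1 * y i)^-1 = g^-1 * (p j * (p i)^-1) * g.
        rewrite -(mulVKg (y j) (p j)) -E invgM invgK !mulgA; congr (_ * g).
        by rewrite -!mulgA mulgV mulg1.
      have [yi _] := yP i; have [yj _] := yP j.
      exact: parabolicM yj (parabolicV yi).
    move/divg1_eq => Eij; have [|_ _ _] := hp i i; first lia.
    by move: Fij; rewrite Eij => -> ; lia.
  rewrite cardE -(size_map r); apply: uniq_leq_size; last first.
    move=> z /mapP[j]; rewrite mem_enum => /andP[_ jB] ->.
    by apply: mem_ball.
  rewrite map_inj_in_uniq ?enum_uniq // => i j _ _ E; apply: val_inj.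
  by case: (ltngtP i j) => // ij; [have := rinj _ _ ij (ltn_ord j)|
    have := rinj _ _ ij (ltn_ord i)]; case.
- apply: card_min => i /andP[iC /asboolP[c [cw cs cf]]].
  have [J' [g' [J'm J'p cJ']]] := shield i c cw cs.
  apply: leq_trans (IHN _ J'm J'p g' n p hp); apply: subset_leq_card.
  apply/fintype.subsetP => j /andP[/andP[jC _] ij]; have jn := ltn_ord j.
  by apply: cJ' => //; apply: cf; lia.
- apply: card_max => i /andP[iC /asboolP[c [cw cs cb]]].
  have [J' [g' [J'm J'p cJ']]] := shield i c cw cs.
  (* Step [i] is counted apart, since its end [p i.+1] may lie across [c]. *)
  rewrite -addn1; apply: leq_trans (leq_add (IHN _ J'm J'p g' n p hp) (leqnn 1)).
  rewrite -{1}(card1 i); apply: leq_trans (cardU_le _ _).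
  apply: subset_leq_card; apply/fintype.subsetP => j /andP[/andP[jC _] ji].
  rewrite !inE orbC; case: eqP => //= nij.
  have ltji : j < i by rewrite ltn_neqAle ji andbT; apply/eqP => /val_inj.
  by apply: cJ' => //; apply: cb; lia.
Qed.
(** * Strongly separated walls along geodesics *)

(** The four points occupy the four quadrants cut out by the walls. *)
Definition cross c d := exists q q' p p', [/\ ~~ sep c q q', ~~ sep c p p',
  sep c q p, sep d q q' & sep d p p'].

Lemma cross_meets x g d : wall d -> cross (halfspace x g) d ->
  meets (link x) g d.
Proof.
move=> dw [q [q' [p [p' [qq pp qp dq dp]]]]].
have -> : link x = link (x, true).1 by [].
have E : halfspace x g = dual g (x, true) by [].
case gq: (sep (halfspace x g) g q).
  apply: (meets_link dw _ _ dp _ _ dq); rewrite -E.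
  - by rewrite (sepD _ _ q) gq qp.
  - by rewrite (sepD _ _ q) gq (sepD _ _ p) qp (negbTE pp).
  - exact: gq.
  - by rewrite (sepD _ _ q) gq (negbTE qq).
apply: (meets_link dw _ _ dq _ _ dp); rewrite -E.
- by rewrite gq.
- by rewrite (sepD _ _ q) gq (negbTE qq).
- by rewrite (sepD _ _ q) gq qp.
- by rewrite (sepD _ _ q) gq (sepD _ _ p) qp (negbTE pp).
Qed.

(** All crossings of [c] fall between the times [i] and [j], so [p 0] and [p n] lie on different
    sides of it. *)
Definition localized c n (p : nat -> G) i j := [/\ wall c, i <= j <= n,
  sep c (p i) (p j) & forall t, t < n -> sep c (p t) (p t.+1) -> i <= t < j].

Lemma localized_before c n (p : nat -> G) i j t : localized c n p i j -> t <= i ->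
  ~~ sep c (p 0) (p t).
Proof.
move=> [cw ij cij H'] ti; apply: nosep_steps => // t' t't.
by apply/negP => /H'; lia.
Qed.

Lemma localized_after c n (p : nat -> G) i j t : localized c n p i j -> j <= t <= n ->
  sep c (p 0) (p t).
Proof.
move=> ci jt; have [cw ij cij H'] := ci.
rewrite (sepD _ _ (p i)) (negbTE (localized_before ci (leqnn i))) /=.
rewrite (sepD _ _ (p j)) cij; apply: nosep_steps => [t' t't|]; last lia.
by apply/negP => /H'; lia.
Qed.

Hypothesis HF : forall B, exists F, forall k, H k -> len k <= B -> Fl k <= F.

(** The ends of a window of length F + 1 are separated by more walls than its first and last [D]
    steps can cross. A remaining wall is crossed in the middle, hence nowhere outside the window. *)
Lemma localized_wall : exists2 W, 0 < W & forall n (p : nat -> G) s,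
  Hgeodesic n p -> s + W <= n -> exists c, localized c n p s (s + W).
Proof.
have [D hD] := wall_steps_bounded; have [F hF] := HF ((D + D) * L)%N.
exists F.+1 => // n p s hp sn; have [|_ _ Hk Fk] := hp s (s + F.+1); first lia.
have [|c [cw cs cT]] := @avoiding_wall n p (iota s D ++ iota (s + F.+1 - D) D)
  (p s) (p (s + F.+1)) hp.
  rewrite size_cat !size_iota ltnNge; apply/negP => /(hF _ Hk).
  by rewrite Fk; lia.
exists c; split=> //; first lia.
have [j sj cj] : exists2 j, s <= j < s + F.+1 & sep c (p j) (p j.+1).
  apply: contrapT => nj; move: cs; apply/negP/nosep_steps; last lia.
  by move=> t ts; apply/negP => st; apply: nj; exists t.
have jD : s + D <= j /\ j < s + F.+1 - D.
  split; rewrite leqNgt; apply/negP => H'; move: cj; apply/negP/cT; try lia;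
  rewrite mem_cat !mem_iota; lia.
move=> t tn ct; apply/andP; split; rewrite leqNgt; apply/negP => H'.
  by have := @hD n p c t j hp cw; rewrite ct cj => /(_ _ _ isT isT); lia.
by have := @hD n p c j t hp cw; rewrite ct cj => /(_ _ _ isT isT); lia.
Qed.

Lemma cross_steps_bounded : exists N, forall c n (p : nat -> G), wall c ->
  Hgeodesic n p ->
  #|[pred i : 'I_n | `[< exists d, [/\ wall d, cross c d & sep d (p i) (p i.+1)] >]]|
  <= N.
Proof.
have [N hN] := crossing_steps_bounded #|V|.
exists N => c n p [x [g ->]] hp.
have xp : exists y, y \in perp (link x).
  by exists x; apply/forall_inP => y; rewrite inE /= e_sym.
apply: leq_trans (hN (link x) (max_card _) xp g n p hp).
apply: subset_leq_card; apply/fintype.subsetP => i /asboolP[d [dw cd sd]].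
by apply/asboolP; exists d => //; apply: cross_meets.
Qed.

(** [p 0], [p j] and [p n] occupy three quadrants; a point [z] in the fourth would make the walls
    cross. *)
Lemma nested c d n (p : nat -> G) i j s t z : localized c n p i j ->
  localized d n p s t -> j <= s -> ~ cross c d ->
  sep d (p 0) z -> sep c (p 0) z.
Proof.
move=> cl dl js ncd dz; apply: contrapT => /negP cz; apply: ncd.
have [_ cij _ _] := cl; have [_ dij _ _] := dl.
have cj : sep c (p 0) (p j) by apply: (localized_after cl); lia.
exists (p 0), z, (p j), (p n); split=> //.
  rewrite (sepD _ _ (p 0)) sep_sym cj (localized_after cl) //; lia.
rewrite (sepD _ _ (p 0)) sep_sym (negbTE (localized_before dl js)).
by rewrite (localized_after dl) //; lia.
Qed.

Lemma nested' c d n (p : nat -> G) i j s t z : localized c n p i j ->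
  localized d n p s t -> j <= s -> ~ cross d c ->
  sep d (p 0) z -> sep c (p 0) z.
Proof.
move=> cl dl js ncd dz; apply: contrapT => /negP cz; apply: ncd.
have [_ cij _ _] := cl; have [_ dij _ _] := dl.
exists (p 0), (p j), (p n), z; split.
- exact: localized_before dl js.
- rewrite (sepD _ _ (p 0)) sep_sym dz (localized_after dl) //; lia.
- by rewrite (localized_after dl) //; lia.
- by rewrite (localized_after cl) //; lia.
- rewrite (sepD _ _ (p 0)) sep_sym (negbTE cz) (localized_after cl) //; lia.
Qed.

Section Chain.
Variables (W N n : nat) (p : nat -> G).
Hypothesis W_gt0 : 0 < W.
Hypothesis hW : forall s, s + W <= n -> exists c, localized c n p s (s + W).
Hypothesis hN : forall c, wall c ->
  #|[pred i : 'I_n | `[< exists d, [/\ wall d, cross c d & sep d (p i) (p i.+1)] >]]|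
  <= N.

(** Pigeonhole: there are 3N + 1 disjoint windows in between, and each of the three walls crosses
    the chosen walls of at most [N] of them. *)
Lemma uncrossed a b c s s' : wall a -> wall b -> wall c ->
  s + (3 * N).+2 * W <= s' <= n ->
  exists d t, [/\ localized d n p t (t + W), s + W <= t, t + W <= s' &
    [/\ ~ cross a d, ~ cross b d & ~ cross c d]].
Proof.
move=> aw bw cw ss'; pose t (i : 'I_(3 * N).+1) := (s + (val i).+1 * W)%N.
have tW (i : 'I_(3 * N).+1) : t i + W <= s'.
  have h : (val i).+2 * W <= (3 * N).+2 * W by rewrite leq_mul2r !ltnS -ltnS ltn_ord orbT.
  by rewrite /t; move: h; rewrite (mulSn (val i).+1); lia.
have /choice[d dl] : forall i, exists d, localized d n p (t i) (t i + W).
  by move=> i; apply: hW; have := tW i; lia.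
pose I c0 := [pred i : 'I_n |
  `[< exists d, [/\ wall d, cross c0 d & sep d (p i) (p i.+1)] >]].
have /choice[f fP] : forall i, exists j : 'I_n,
    sep (d i) (p j) (p j.+1) /\ t i <= j < t i + W.
  move=> i; have [_ ti sd dst] := dl i; apply: contrapT => nj.
  move: sd; apply/negP/nosep_steps; last lia.
  move=> j tj; have jn : j < n by lia.
  by apply/negP => sj; apply: nj; exists (Ordinal jn).
have finj : injective f.
  move=> i j E; apply: val_inj; have [_ ] := fP i; have [_] := fP j.
  rewrite E /t; case: (ltngtP i j) => // ij.
    have : (val i).+2 * W <= (val j).+1 * W by rewrite leq_mul2r ltnS ij orbT.
    rewrite (mulSn (val i).+1); lia.
  have : (val j).+2 * W <= (val i).+1 * W by rewrite leq_mul2r ltnS ij orbT.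
  rewrite (mulSn (val j).+1); lia.
case: (pselect (exists i, f i \notin [predU I a & [predU I b & I c]])) => [[i iI]|nI].
  have [dw _ _ _] := dl i; have [si _] := fP i.
  exists (d i), (t i); split=> //.
    rewrite /t leq_add2l mulSn; exact: leq_addr.
  split=> xd; move/negP: iI; apply; apply/orP.
  - by left; apply/asboolP; exists (d i).
  - by right; apply/orP; left; apply/asboolP; exists (d i).
  - by right; apply/orP; right; apply/asboolP; exists (d i).
have : #|[seq f i | i : 'I_(3 * N).+1]| <= #|[predU I a & [predU I b & I c]]|.
  apply: subset_leq_card; apply/fintype.subsetP => j /codomP[i ->].
  by apply: contrapT => /negP H'; apply: nI; exists i.
rewrite card_codom // card_ord => /leq_trans/(_ (cardU_le _ _)).
move=> /leq_trans/(_ (leq_add (hN aw) (cardU_le _ _))).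
move=> /leq_trans/(_ (leq_add (leqnn _) (leq_add (hN bw) (hN cw)))); lia.
Qed.

Variables (a b : set G) (s s' : nat).
Hypotheses (al : localized a n p s (s + W)) (bl : localized b n p s' (s' + W)).
Hypothesis ss' : s + (3 * N).+2 * W <= s'.

Lemma far_nested z : sep b (p 0) z -> sep a (p 0) z.
Proof.
have [aw _ _ _] := al; have [bw s'n _ _] := bl.
have [|d [t [dl st ts' [nad nbd _]]]] := @uncrossed a b a s s' aw bw aw; first lia.
by move=> /(nested' dl bl ts' nbd)/(nested al dl st nad).
Qed.

(** Some wall [c] in between crosses none of [a], [b], [d], whereas a wall crossing both [a] and [b]
    would also cross [c]. *)
Lemma strongly_separated d : wall d -> cross a d -> ~ cross b d.
Proof.
move=> dw; have [aw _ _ _] := al; have [bw s'n _ _] := bl.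
have [|c [t [cl st ts' [nac nbc ndc]]]] := @uncrossed a b d s s' aw bw dw; first lia.
have side c0 : cross c0 d -> (exists q q', [/\ ~~ sep c0 (p 0) q, ~~ sep c0 (p 0) q' &
    sep d q q']) /\ (exists q q', [/\ sep c0 (p 0) q, sep c0 (p 0) q' & sep d q q']).
  move=> [q [q' [r [r' [qq rr qr dq dr]]]]].
  have rE : sep c0 (p 0) r = ~~ sep c0 (p 0) q by rewrite (sepD _ _ q) qr addbT.
  have r'E : sep c0 (p 0) r' = ~~ sep c0 (p 0) q.
    by rewrite (sepD _ _ r) rE (negbTE rr) addbF.
  have q'E : sep c0 (p 0) q' = sep c0 (p 0) q by rewrite (sepD _ _ q) (negbTE qq) addbF.
  case cq: (sep c0 (p 0) q) in rE r'E q'E *; split.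
  - by exists r, r'; rewrite rE r'E.
  - by exists q, q'; rewrite cq q'E.
  - by exists q, q'; rewrite cq q'E.
  - by exists r, r'; rewrite rE r'E.
move=> /side[[q [q' [aq aq' dq]]] _] /side[_ [r [r' [br br' dr]]]].
have cN z : ~~ sep a (p 0) z -> sep c (p 0) z = false.
  by move=> nau; apply/negbTE; apply: contra nau; apply: nested al cl st nac.
have cP z : sep b (p 0) z -> sep c (p 0) z by apply: nested' cl bl ts' nbc.
(* [q], [q'] lie before [c] and [r], [r'] beyond it; [qr] decides how to pair them into
   quadrants. *)
apply: ndc; case qr: (sep d q r).
  exists q, r', q', r; split.
  - by rewrite (sepD _ _ r) qr dr.
  - by rewrite (sepD _ _ q) sep_sym dq qr.
  - by [].
  - by rewrite (sepD _ _ (p 0)) sep_sym cN // cP.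
  - by rewrite (sepD _ _ (p 0)) sep_sym cN // cP.
exists q, r, q', r'; split.
- by rewrite qr.
- by rewrite (sepD _ _ q) sep_sym dq (sepD _ _ r) qr dr.
- by [].
- by rewrite (sepD _ _ (p 0)) sep_sym cN // cP.
- by rewrite (sepD _ _ (p 0)) sep_sym cN // cP.
Qed.

(* A wall separating [p i] from both [z] and [z'] meets the geodesic between the
   two strongly separated walls. *)
Lemma bottleneck z z' i : s' + W <= i <= n -> ~~ sep a (p 0) z ->
  sep b (p 0) z' -> dist z (p i) <= dist z z' + dist (p s) (p i).
Proof.
move=> s'i az bz'; have [aw sn _ _] := al; have [bw s'n _ _] := bl.
have [l [ul <-] lP] := sep_walls_ex z (p i).
rewrite -(count_predC (fun c => sep c z z')) -!size_filter.
apply: leq_add; apply: size_sep; rewrite ?filter_uniq // => c.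
  by rewrite mem_filter => /andP[cz /lP[]].
rewrite mem_filter /= => /andP[ncz /lP[cw czi]]; split=> //.
apply: contrapT => /negP csi.
have ss'W : s <= s' by lia.
have bz : ~~ sep b (p 0) z by apply: contra az; apply: far_nested.
have az' := far_nested bz'.
have zs : sep c z (p s) by rewrite (sepD _ _ (p i)) czi sep_sym (negbTE csi).
have iz' : sep c (p i) z' by rewrite (sepD _ _ z) sep_sym czi (negbTE ncz).
have ai : sep a (p 0) (p i) by apply: (localized_after al); lia.
have bi : sep b (p 0) (p i) by apply: (localized_after bl); lia.
have as' := localized_before al (leqnn s); have bs := localized_before bl ss'W.
apply: (strongly_separated cw).
  exists z, (p s), (p i), z'; split=> //; rewrite (sepD _ _ (p 0)) sep_sym.
  - by rewrite (negbTE az) (negbTE as').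
  - by rewrite ai az'.
  - by rewrite (negbTE az) ai.
exists z, (p s), (p i), z'; split=> //; rewrite (sepD _ _ (p 0)) sep_sym.
- by rewrite (negbTE bz) (negbTE bs).
- by rewrite bi bz'.
- by rewrite (negbTE bz) bi.
Qed.

End Chain.
(** * Stability of quasi-geodesics *)

Local Open Scope nat_scope.

Hypothesis HG : forall h h', H h -> H h' ->
  exists n (p : nat -> G), [/\ Hgeodesic n p, p 0 = h & p n = h'].

Lemma dist_Hgeodesic n (p : nat -> G) i j : Hgeodesic n p -> i <= j <= n ->
  dist (p i) (p j) <= (j - i) * L.
Proof.
move=> hp; elim: j => [|j IHj] ij; first by rewrite (_ : i = 0) ?distp //; lia.
have [->|nij] := eqVneq i j.+1; first by rewrite distp.
apply: leq_trans (distD _ (p j) _) _; rewrite subSn; last lia.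
by rewrite mulSn addnC leq_add ?(Hstep hp) ?IHj //; lia.
Qed.

Definition quasi_geodesic_nat (K C N : nat) (w : nat -> G) := forall i j, i <= j <= N ->
  j - i <= K * dist (w i) (w j) + C /\ dist (w i) (w j) <= K * (j - i) + C.

(** The path [w] is cut at the last times before it passes successive walls. [bottleneck] bounds the
    distance from a cut to the geodesic of [H] by the time to the next cut, so [good_times_dense]
    yields a dense set of cuts close to [H]. *)
Lemma stability (K C : nat) : exists M, forall N (w : nat -> G),
  quasi_geodesic_nat K C N w -> H (w 0) -> H (w N) ->
  forall i, i <= N -> exists2 h, H h & dist (w i) h <= M.
Proof.
have [W W0 hW] := localized_wall; have [N0 hN] := cross_steps_bounded.
(* Localized walls whose windows start [B] apart are strongly separated; [A] bounds the distance
   covered by [B] steps of [p]. *)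
pose B := ((3 * N0).+2 * W)%N; pose A := (B * L)%N.
pose C1 := (K + C + 2 * A)%N.
have [M hM] := good_times_dense K C C1 A.
exists (K * M + C + M)%N => N w qw Hw0 HwN.
have [n [p [hp p0 pn]]] := HG Hw0 HwN.
have WB : W <= B by rewrite /B mulSn leq_addr.
have B0 : 0 < B by apply: leq_trans WB.
pose m := n %/ B.
have mB j : j < m -> j.+1 * B <= n.
  by move=> jm; apply: leq_trans (leq_trunc_div n B); rewrite leq_mul2r jm orbT.
have /choice[a al] : forall j, exists c, j < m -> localized c n p (j * B) (j * B + W).
  move=> j; case: (ltnP j m) => [jm|_]; last by exists set0.
  have [|c cl] := hW n p (j * B)%N hp; last by exists c.
  by have := mB j jm; rewrite mulSn; lia.
have nest j z : j.+1 < m -> sep (a j.+1) (p 0) z -> sep (a j) (p 0) z.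
  move=> jm; apply: (far_nested W0 (fun s => @hW n p s hp) (fun c cw => hN c n p cw hp)
    (al j (ltnW jm)) (al _ jm)).
  by rewrite mulSn addnC.
have ap j i : j < m -> i <= j * B -> ~~ sep (a j) (p 0) (p i).
  by move=> jm; apply: localized_before (al j jm).
have pa j i : j < m -> j.+1 * B <= i <= n -> sep (a j) (p 0) (p i).
  by move=> jm ji; apply: (localized_after (al j jm)); move: ji; rewrite mulSn; lia.
(* [t j] is the last time at which [w] is before the wall [a j]. *)
have /choice[t tP] : forall j, exists t, j < m -> [/\ t < N, ~~ sep (a j) (p 0) (w t) &
    forall i, t < i <= N -> sep (a j) (p 0) (w i)].
  move=> j; case: (ltnP j m) => [jm|_]; last by exists 0.
  have ex : exists t, (t <= N) && ~~ sep (a j) (p 0) (w t).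
    by exists 0; rewrite -p0 sepp.
  have ub t : (t <= N) && ~~ sep (a j) (p 0) (w t) -> t <= N by case/andP.
  case: (ex_maxnP ex ub) => t /andP[tN at_] tmax; exists t => _; split=> //.
    rewrite ltn_neqAle tN andbT; apply: contraNneq at_ => ->.
    by rewrite -pn; apply: pa => //; rewrite mB /=.
  move=> i ti; apply: contrapT => /negP ai; have := tmax i; rewrite ai; lia.
(* The index is shifted: [T j.+1] belongs to [a j], while [X j.+1] lies beyond [a j.+1], if there is
   such a wall, as [bottleneck] requires. *)
pose T i := if i is j.+1 then if j < m then t j else N else 0.
pose X j := p (minn (j.+1 * B) n).
have XH j : H (X j) by have [|//] := hp (minn (j.+1 * B) n) n; rewrite geq_minr leqnn.
have XE j : m <= j -> X j = w N.
  move=> mj; rewrite /X (minn_idPr _) ?pn //.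
  apply: leq_trans (ltnW (ltn_ceil n B0)) _; by rewrite leq_mul2r ltnS mj orbT.
have Xd i j : i <= j -> dist (X i) (X j) <= A * (j - i).
  move=> ij; apply: leq_trans (dist_Hgeodesic hp _) _.
    by rewrite geq_minr andbT leq_min geq_minr andbT (leq_trans (geq_minl _ _)) //
      leq_mul2r ltnS ij orbT.
  rewrite /A -mulnA (mulnC L) mulnA leq_mul2r; apply/orP; right.
  have -> : (B * (j - i))%N = (j.+1 * B - i.+1 * B)%N by rewrite -mulnBl subSS mulnC.
  lia.
pose delta j := dist (w (T j)) (X j).
have TN j : T j <= N.
  by case: j => //= j; case: ifP => // /tP[/ltnW].
have Tm j : j <= m -> T j <= T j.+1.
  case: j => //= j jm; rewrite jm; have [tN jt _] := tP j jm.
  case: ltnP => [jm'|_]; last exact: ltnW.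
  have [_ _ tmax] := tP _ jm'; rewrite leqNgt; apply/negP => lt.
  by move/negP: jt; apply; apply: nest => //; apply: tmax; rewrite lt ltnW.
have d0 : delta 0 <= C1.
  apply: leq_trans (_ : A <= _); last by rewrite /C1; lia.
  rewrite /delta /= -p0; apply: leq_trans (dist_Hgeodesic hp _) _.
    by rewrite geq_minr.
  by rewrite subn0 mul1n leq_mul2r geq_minl orbT.
have dN : delta m.+1 <= C1 by rewrite /delta /= ltnn XE // distp.
have dj j : 0 < j <= m -> delta j <= K * (T j.+1 - T j) + C1.
  case: j => // j /= jm; rewrite /delta /= jm; have [tN jt _] := tP j jm.
  case: ltnP => [jm'|mj].
    have [tN' _ tmax] := tP _ jm'.
    have tt' : t j <= t j.+1 by have := Tm j.+1 jm; rewrite /= jm jm'.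
    have ss' : j * B + (3 * N0).+2 * W <= j.+1 * B by rewrite mulSn addnC.
    have bn := bottleneck W0 (fun s => @hW n p s hp) (fun c cw => hN c n p cw hp)
      (al j jm) (al _ jm') ss'.
    have iB : j.+1 * B + W <= j.+2 * B <= n.
      by rewrite mB // (mulSn j.+1) addnC leq_add2r WB.
    (* One step after [t j.+1] the path is beyond [a j.+1]; this extra step accounts for the summand
       [K] of [C1]. *)
    have bj : sep (a j.+1) (p 0) (w (t j.+1).+1) by apply: tmax; rewrite leqnn.
    rewrite /X (minn_idPl _) ?mB //; apply: leq_trans (bn _ _ _ iB jt bj) _.
    have [|_ le] := qw (t j) (t j.+1).+1; first by rewrite tN' leqW.
    have pd : dist (p (j * B)) (p (j.+2 * B)) <= 2 * A.
      apply: leq_trans (dist_Hgeodesic hp _) _.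
        by rewrite mB // andbT leq_mul2r (leq_trans (leqnSn j)) ?orbT.
      by rewrite -mulnBl (_ : j.+2 - j = 2) ?mulnA //; lia.
    have tS : (t j.+1).+1 - t j = (t j.+1 - t j).+1 by rewrite subSn.
    by move: le; rewrite tS mulnS /C1; lia.
  rewrite XE //; have [|_ le] := qw (t j) N; first by rewrite ltnW // leqnn.
  by apply: leq_trans le _; rewrite leq_add2l /C1; lia.
have TT i j : i <= j <= m.+1 ->
    T j - T i <= K * (delta i + A * (j - i) + delta j) + C.
  case/andP=> ij jm; have TTij : T i <= T j.
    elim: j ij jm => [|j IHj]; first by case: i.
    rewrite leq_eqVlt => /orP[/eqP ->//|ij jm]; apply: leq_trans (Tm j jm).
    by apply: IHj => //; apply: ltnW.
  have [|le _] := qw (T i) (T j); first by rewrite TTij TN.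
  apply: leq_trans le _; rewrite leq_add2r leq_mul2l; apply/orP; right.
  apply: leq_trans (distD _ (X j) _) _; rewrite (distC (X j)) leq_add2r.
  by apply: leq_trans (distD _ (X i) _) _; rewrite leq_add2l Xd.
move=> i iN.
have TE : T m.+1 = N by rewrite /= ltnn.
have [j [jm Tij dM]] := hM m N T delta (erefl _) TE Tm d0 dN dj TT i iN.
exists (X j) => //; apply: leq_trans (distD _ (w (T j)) _) _; rewrite distC.
apply: leq_add dM; have [|_ le] := qw (T j) i; first lia.
by apply: leq_trans le _; rewrite leq_add2r leq_mul2l; apply/orP; right; lia.
Qed.

End Loxodromic.

Local Open Scope group_scope.
(** * Finite height and join subgroups *)

Section JoinElements.
Variables (H : set G) (n : nat).
Hypotheses (Hs : is_subgroup H) (Hn : height_bound H n).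
Hypothesis e_connected : forall A : {pred V},
  (forall x y, e x y -> x \in A -> y \in A) -> (exists x, x \in A) ->
  forall x, x \in A.

Definition conj_mem g k := H (g^-1 * k * g).

Lemma conj_setE g k : conj_set g H k <-> conj_mem g k.
Proof.
rewrite /conj_mem; split=> [[h Hh <-]|Hk]; first by rewrite -!mulgA mulVg mulg1 mulKg.
by exists (g^-1 * k * g) => //; rewrite !mulgA mulgV mul1g mulgK.
Qed.

Lemma conj_memX g k (i : nat) : conj_mem g k -> conj_mem g (k ^+ i).
Proof.
have [H1 HM _] := subgroup_mem Hs; rewrite /conj_mem => Hk.
rewrite -conj_expg; elim: i => [|i IHi]; first by rewrite expg0.
by rewrite expgS; apply: HM.
Qed.

Lemma left_coset_eq g h : left_coset g H = left_coset h H <-> H (g^-1 * h).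
Proof.
have [H1 HM HV] := subgroup_mem Hs; split=> [E|Hgh].
  have : left_coset h H h by exists 1; rewrite ?mulg1.
  by rewrite -E => -[a Ha <-]; rewrite mulKg.
apply/seteqP; split=> _ [a Ha <-].
  exists ((g^-1 * h)^-1 * a); first exact/HM/Ha/HV.
  by rewrite invgM invgK !mulgA mulgV mul1g.
exists (g^-1 * h * a); first exact: HM.
by rewrite !mulgA mulgV mul1g.
Qed.

Lemma powers_infinite k (A : set G) : k != 1 -> (forall i, A (k ^+ i)) ->
  infinite_set A.
Proof.
move=> k1 kA /finite_seqP[s AE].
have inj i j : i < j -> k ^+ i <> k ^+ j.
  move=> ij E; move/eqP: k1; apply; apply: (@torsion_free _ (j - i)); first lia.
  by apply: (mulgI (k ^+ i)); rewrite -expgnDr mulg1 subnKC // ltnW.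
have : size [seq k ^+ i | i <- iota 0 (size s).+1] <= size s.
  apply: uniq_leq_size.
    rewrite map_inj_uniq ?iota_uniq // => i j E; case: (ltngtP i j) => // ij.
      by case: (inj _ _ ij).
    by case: (inj _ _ ij).
  by move=> z /mapP[i _ ->]; have := kA i; rewrite AE.
by rewrite size_map size_iota ltnn.
Qed.

(** If the n + 1 cosets of z^i g were distinct, the powers of [k] would lie in all their conjugates.
    So some z^m with 0 < m <= n lies in the conjugate by [g], and m divides n!. *)
Lemma commuting_power g k z : conj_mem g k -> k != 1 -> commute z k ->
  conj_mem g (z ^+ n`!).
Proof.
move=> gk k1 zk; have [m mn zm] : exists2 m : nat, 0 < m <= n & conj_mem g (z ^+ m).
  pose f (i : 'I_n.+1) := z ^+ i * g.
  case: (pselect (injective (fun i => left_coset (f i) H))) => [finj|ninj].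
    case: (powers_infinite k1 _ (Hn finj)) => j i _; apply/conj_setE.
    rewrite /conj_mem /f invgM -!mulgA (mulgA (k ^+ j)).
    rewrite -(commuteX2 i j zk) -mulgA mulKg mulgA.
    exact: conj_memX.
  have /existsNP[i /existsNP[j /not_implyP[E ij]]] := ninj.
  wlog lt : i j E ij / i < j.
    move=> wl; case: (ltngtP i j) => [/wl|ji|/val_inj //]; first exact.
    by apply: (wl j i) => //; apply: nesym.
  exists (j - i); first by have := ltn_ord j; lia.
  move/left_coset_eq: E; rewrite /f /conj_mem -{1}(subnKC (ltnW lt)) expgnDr.
  by rewrite invgM -!mulgA mulKg.
have /dvdnP[q ->] : m %| n`! by rewrite dvdn_fact.
by rewrite mulnC expgnA; apply: conj_memX.
Qed.

Definition full_powers g := forall x, conj_mem g (lt (x, true) ^+ n`!).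

Lemma gen_neq1 l i : 0 < i -> lt l ^+ i != 1.
Proof.
by move=> i0; apply/eqP => /(congr1 (fun k : G => len k)); rewrite expg_len len1; lia.
Qed.

(** Adjacent vertices commute, so [commuting_power] carries the property along the edges of the
    connected graph. *)
Lemma full_powers_ex g x i : 0 < i -> conj_mem g (lt (x, true) ^+ i) -> full_powers g.
Proof.
move=> i0 gx; pose A : {pred V} := [pred y | `[< conj_mem g (lt (y, true) ^+ n`!) >]].
suff AT : forall y, y \in A by move=> y; apply/asboolP; apply: (AT y).
apply: e_connected => [y z eyz /asboolP Ay|]; last first.
  exists x; apply/asboolP; apply: (commuting_power gx); first exact: gen_neq1.
  exact/commuteX/commute_refl.
apply/asboolP; apply: (commuting_power Ay); first by rewrite gen_neq1 // fact_gt0.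
by apply/commuteX/lt_comm; rewrite e_sym.
Qed.

(** Multiplying [g] by a letter preserves the property for the vertex of this letter, since its
    powers commute with it; [full_powers_ex] recovers the other vertices. *)
Lemma full_powersT g h x : full_powers g -> full_powers h.
Proof.
move=> gP; have [u uE _] := geod_ex (h * g^-1).
have -> : h = el u * g by rewrite uE mulgVK.
elim: u {uE} => [|l u IHu]; first by rewrite el_nil mul1g.
have E : 0 < n`! by exact: fact_gt0.
apply: (@full_powers_ex _ l.1 _ E).
have := IHu l.1; rewrite /conj_mem el_cons !invgM -!mulgA => Hu.
have c : commute (lt (l.1, true) ^+ n`!) (lt l).
  apply/commute_sym/commuteX; case: l {Hu} => y [] //=.
  rewrite -[false]/(~~ true) lt_inv; exact/commute_sym/commuteV/commute_refl.
by rewrite (mulgA (_ ^+ _) (lt l)) c -mulgA mulKg.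
Qed.

(** Otherwise the conjugates for n + 1 distinct cosets would share infinitely many powers of a
    vertex. *)
Lemma finite_cosets : (forall g, full_powers g) -> (exists x : V, True) ->
  exists s : seq G, forall g, exists2 r, r \in s & left_coset g H = left_coset r H.
Proof.
move=> full [x _]; apply: contrapT => ns.
have /choice[f fP] : forall s : seq G, exists g, forall r, r \in s ->
    left_coset g H <> left_coset r H.
  move=> s; apply: contrapT => ng; apply: ns; exists s => g; apply: contrapT => nr.
  by apply: ng; exists g => r rs E; apply: nr; exists r.
pose s i := iter i (fun t => f t :: t) [::].
have ss i : size (s i) = i by elim: i => //= i ->.
have su i : uniq [seq left_coset g H | g <- s i].
  elim: i => //= i ->; rewrite andbT; apply/negP => /mapP[r rs E].
  by case: (fP _ _ rs E).
pose g (i : 'I_n.+1) := nth 1 (s n.+1) i.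
have ginj : injective (fun i => left_coset (g i) H).
  move=> i j E; apply: val_inj => /=; apply/eqP.
  have := su n.+1; move/(nth_uniq (left_coset 1 H)).
  move=> /(_ i j); rewrite !size_map !ss => /(_ (ltn_ord i) (ltn_ord j)) <-.
  by rewrite !(nth_map 1) ?ss //; apply/eqP.
apply: (powers_infinite (gen_neq1 (x, true) (fact_gt0 n)) _ (Hn ginj)) => i j _.
by apply/conj_setE/conj_memX/full.
Qed.

(** Write the conjugate of [k] as a b. If a = 1, a vertex of [J] commutes with it; otherwise a^(n!)
    is available, is nontrivial, and commutes with a vertex of [perp J]. Either way a power of a
    vertex is reached. *)
Lemma join_element_finite_index J g k : (exists x, x \in J) ->
  (exists y, y \in perp J) -> H k -> k != 1 ->
  parabolic [predU J & perp J] (g^-1 * k * g) ->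
  exists M, forall h, exists2 h', H h' & dist h h' <= M.
Proof.
move=> [x xJ] [y yJ] Hk k1 kJ.
have [a [b [aJ bJ kE]]] := parabolicU (@perpP J) kJ.
have cu : conj_mem g^-1 (g^-1 * k * g).
  by rewrite /conj_mem invgK -!mulgA mulgV mulg1 mulVKg.
have u1 : g^-1 * k * g != 1.
  apply: contra k1 => /eqP E; apply/eqP; apply: (mulgI g^-1); apply: (mulIg g).
  by rewrite E mulg1 mulVg.
have cab := parabolic_comm (@perpP J) aJ bJ.
have [z zP] : exists z : V, conj_mem g^-1 (lt (z, true) ^+ n`!).
  have [a1|a1] := eqVneq a 1.
    exists x; apply: (commuting_power cu u1); rewrite kE a1 mul1g.
    exact: parabolic_comm (@perpP J) (parabolic_lt _) bJ.
  have ca : conj_mem g^-1 (a ^+ n`!).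
    apply: (commuting_power cu u1); rewrite kE.
    exact: commuteM (commute_refl a) cab.
  exists y; apply: (commuting_power ca).
    by apply/eqP => /(torsion_free (fact_gt0 n))/eqP; apply/negP.
  apply/commuteX/commute_sym; exact: parabolic_comm (@perpP J) aJ (parabolic_lt _).
have full h : full_powers h.
  apply: (full_powersT (g := g^-1)) => //; exact: full_powers_ex (fact_gt0 n) zP.
have [|s sP] := finite_cosets full; first by exists x.
exists (\max_(r <- s) len r) => h; have [r rs E] := sP h^-1.
exists (h * r); last by rewrite /dist mulKg; apply: (leq_bigmax_seq _ rs).
by move/left_coset_eq: E; rewrite invgK.
Qed.

End JoinElements.
(** * Connectedness of the defining graph *)

(** For [J] a union of components of the graph, the group is a free product, and this set of
    elements can be left only through 1. *)
Definition starts_in J k := exists2 l, l.1 \in J & sep (dual 1 l) 1 k.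

Section OneEnded.
Variable A : {pred V}.
Hypothesis A_closed : forall x y, e x y -> x \in A -> y \in A.

Lemma starts_in_geod l u : geod (l :: u) -> sep (dual 1 l) 1 (el (l :: u)).
Proof.
move=> gu; rewrite -[el _]mul1g -geod_sep ?inE ?eqxx //; exact: wall_dual.
Qed.

Lemma starts_in_power n l : 0 < n -> starts_in A (lt l ^+ n) <-> l.1 \in A.
Proof.
case: n => // n _; have sl : sep (dual 1 l) 1 (lt l ^+ n.+1).
  by rewrite -el_nseq; apply: starts_in_geod; apply: (@geod_nseq n.+1).
split=> [[m mA sm]|lA]; last by exists l.
have [->//|nlm] := eqVneq l.1 m.1.
apply: (A_closed _ mA); apply: (adjacent_halfspaces sm sl).
by apply/eqP => /halfspace_inj[E _]; rewrite E eqxx in nlm.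
Qed.

(** Crossing back the wall of [m] leads into the parabolic of its link, whose nontrivial elements
    start with a neighbour of [m]. *)
Lemma starts_in_step k l : starts_in A k -> k * lt l != 1 -> starts_in A (k * lt l).
Proof.
move=> [m mA sm] kl; have dw := wall_dual 1 m.
case sml: (sep (dual 1 m) 1 (k * lt l)); first by exists m.
have : sep (dual 1 m) k (k * lt l) by rewrite (sepD _ _ 1) sep_sym sm sml.
rewrite sep_dual // => /eqP/esym/dual_endpoint[].
  by move/link_nosep; rewrite sm.
rewrite invg1 mul1g; have [[|t u] uE gu] := geod_ex (k * lt l).
  by rewrite -uE el_nil eqxx in kl.
rewrite -uE => /(geod_retract gu)/= /andP[tm _].
by exists t; [apply: A_closed tm mA|apply: starts_in_geod].
Qed.

Lemma starts_in_word k u : size u < len k -> starts_in A k -> starts_in A (k * el u).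
Proof.
elim: u k => [|l u IHu] k /= uk Ak; first by rewrite el_nil mulg1.
have le : len k <= len (k * lt l) + 1.
  rewrite -{1}(mulgK (lt l) k); apply: leq_trans (lenM _ _) _.
  by rewrite lenV leq_add2l len_lt.
rewrite el_cons mulgA; apply: IHu.
  by have := leq_trans uk le; rewrite addn1 ltnS.
apply: starts_in_step => //; apply/eqP => E.
by move: (leq_trans uk le); rewrite E len1.
Qed.

Variables (S : seq G) (L : nat).
Hypothesis SL : forall s, s \in S -> len s <= L.

(** Outside the ball of radius [L], each edge is replaced by a word too short to reach 1. *)
Lemma starts_in_path k (p : seq G) : path (cayley_adj S) k p ->
  (forall z, z \in k :: p -> L < len z) -> starts_in A k -> starts_in A (last k p).
Proof.
elim: p k => //= h p IHp k /andP[/andP[_ kh] hp] far Ak; apply: IHp => //.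
  by move=> z zp; apply: far; rewrite inE zp orbT.
have : len (k^-1 * h) <= L.
  by case/orP: kh => /SL //; rewrite -lenV invgM invgK.
have [u uE /eqP gu] := geod_ex (k^-1 * h); rewrite -uE gu => uL.
rewrite -(mulVKg k h) -uE; apply: starts_in_word => //.
by apply: leq_ltn_trans uL _; apply: far; rewrite mem_head.
Qed.

(** Translates of a fixed path from 1 to [lt l] join consecutive powers and avoid the ball once the
    exponent is large. *)
Lemma component_powers l : generates S -> exists N0, forall N, N0 <= N ->
  L < N /\ forall i, component S [set k | len k <= L] (lt l ^+ N) (lt l ^+ (N + i)).
Proof.
move=> Sg; have [p pP pl] := generates_linked 1 (lt l) Sg.
pose B := \max_(z <- 1 :: p) len z; exists (L + B).+1 => N NB; split; first lia.
have far i z : L + B < i -> z \in [seq lt l ^+ i * t | t <- 1 :: p] -> L < len z.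
  move=> iB /mapP[t tp ->]; have tB : len t <= B by apply: (leq_bigmax_seq _ tp).
  have := lenM (lt l ^+ i * t) t^-1; rewrite mulgK expg_len lenV; lia.
elim=> [|i [q [qP ql qK]]].
  exists [::]; rewrite addn0; split=> // z; rewrite inE => /eqP ->.
  by rewrite /= expg_len; lia.
exists (q ++ [seq lt l ^+ (N + i) * t | t <- p]); split.
- rewrite cat_path qP ql -{1}(mulg1 (_ ^+ (N + i))) path_map.
  rewrite (eq_path (e' := cayley_adj S)) // => a b /=; exact: adjM.
- rewrite last_cat ql -{1}(mulg1 (_ ^+ (N + i))) last_map pl addnS.
  by rewrite expgSr.
move=> z; rewrite -cat_cons mem_cat => /orP[/qK //|zp] /=.
apply/negP; rewrite -ltnNge; apply: (far (N + i)); first lia.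
by rewrite inE zp orbT.
Qed.

End OneEnded.

(** High powers of a vertex in [A] and of one outside [A] would lie in the same infinite component,
    but a path avoiding the ball preserves [starts_in A]. *)
Lemma one_ended_connected (A : {pred V}) : one_ended G ->
  (forall x y, e x y -> x \in A -> y \in A) -> (exists x, x \in A) ->
  forall x, x \in A.
Proof.
move=> [S Sg hK] A_closed [x xA] y; apply: contrapT => yA.
pose L := \max_(s <- S) len s.
have SL s : s \in S -> len s <= L by move=> sS; apply: (leq_bigmax_seq _ sS).
pose K := [set k : G | len k <= L].
have Kfin : finite_set K.
  by apply: (sub_finite_set (B := [set` ball L])); [move=> k /mem_ball|].
have [Nx hx] := component_powers L (x, true) Sg.
have [Ny hy] := component_powers L (y, true) Sg.
pose N := maxn Nx Ny.
have [LN cx] := hx N (leq_maxl _ _); have [_ cy] := hy N (leq_maxr _ _).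
have inf l : (forall i, component S K (lt l ^+ N) (lt l ^+ (N + i))) ->
    infinite_set (component S K (lt l ^+ N)).
  move=> cl /finite_seqP[s sE]; pose m := \max_(z <- s) len z.
  have : lt l ^+ (N + m.+1) \in s by have := cl m.+1; rewrite sE.
  move=> zs; have := @leq_bigmax_seq _ s xpredT (fun z : G => len z) _ zs isT.
  by rewrite -/m expg_len; lia.
have [C [_ uC]] := hK K Kfin.
have E : component S K (lt (x, true) ^+ N) = component S K (lt (y, true) ^+ N).
  rewrite -(uC _ (conj (inf _ cx) (ex_intro _ _ erefl))).
  by rewrite -(uC _ (conj (inf _ cy) (ex_intro _ _ erefl))).
have := cy 0; rewrite addn0 -E => -[p [pP pl pK]].
have N0 : 0 < N by apply: leq_ltn_trans LN.
have : starts_in A (lt (y, true) ^+ N).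
  rewrite -pl; apply: (starts_in_path A_closed SL pP).
    by move=> z /pK /negP; rewrite -ltnNge.
  by apply/starts_in_power.
by move/(starts_in_power A_closed _ N0).
Qed.
(** * Quasiconvexity of subgroups of finite height *)

Definition vertex_gens : seq G := [seq lt (x, true) | x <- enum V].

Lemma mem_vertex_gens x : lt (x, true) \in vertex_gens.
Proof. by apply: map_f; rewrite mem_enum. Qed.

Lemma vertex_gens_adj k l : cayley_adj vertex_gens k (k * lt l).
Proof.
have l1 : lt l != 1 by have := gen_neq1 l (ltn0Sn 0); rewrite expg1.
apply/andP; split.
  by apply: contra l1 => /eqP E; apply/eqP/(mulgI k); rewrite -E mulg1.
rewrite invgM mulKg mulgVK; case: l {l1} => x [].
  by rewrite mem_vertex_gens.
by rewrite (lt_inv x true) invgK mem_vertex_gens orbT.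
Qed.

Lemma vertex_gens_path k u : exists2 p : seq G, path (cayley_adj vertex_gens) k p &
  last k p = k * el u /\ size p = size u.
Proof.
elim: u k => [|l u IHu] k; first by exists [::]; rewrite ?mulg1.
have [p kp [pl ps]] := IHu (k * lt l); exists (k * lt l :: p).
  by rewrite /= vertex_gens_adj.
by rewrite /= pl ps el_cons mulgA.
Qed.

Lemma vertex_gens_generate : generates vertex_gens.
Proof.
rewrite /generates -subTset => k _.
have [u uE _] := geod_ex k; have [p kp [pl _]] := vertex_gens_path 1 u.
rewrite -(mul1g k) -invg1; apply: linked_generated; exists p => //.
by rewrite pl mul1g.
Qed.

Lemma cdist_vertex_gens p q : cdist vertex_gens p q = dist p q.
Proof.
apply/eqP; rewrite eqn_leq; apply/andP; split.
  have [u -> gu] := geodesic p q; have [s ps [sl su]] := vertex_gens_path p u.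
  by rewrite dist_geod // -su -sl cdist_le.
have [s [ps <- <-]] := cdist_path (generates_linked p q vertex_gens_generate).
elim: s p ps => [|r s IHs] p /=; first by rewrite distp.
case/andP => /andP[_ pr] /IHs rs; apply: leq_trans (distD _ r _) _.
rewrite -add1n leq_add //; case/orP: pr => /mapP[x _ E].
  by rewrite /dist E len_lt.
by rewrite distC /dist E len_lt.
Qed.

(** Either [H] meets conjugates of join subgroups trivially and [stability] applies, or some
    nontrivial element of it is in one and every point is close to [H]. *)
Lemma finite_height_stability (H : set G) : one_ended G -> is_subgroup H ->
  finitely_generated H -> finite_height H ->
  forall K C : nat, exists M, forall N (w : nat -> G),
    quasi_geodesic_nat K C N w -> H (w 0) -> H (w N) ->
    forall i, i <= N -> exists2 h, H h & dist (w i) h <= M.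
Proof.
move=> oe Hs [F HE] [n [hn _]] K C.
have [H1 HM HV] := subgroup_mem Hs.
case: (pselect (loxodromic H)) => [Hlox|]; last first.
  move/existsNP=> [J /existsNP[g /existsNP[k]]].
  move=> /not_implyP[xJ /not_implyP[yJ /not_implyP[Hk /not_implyP[kJ /eqP k1]]]].
  have [M hM] := join_element_finite_index Hs hn (@one_ended_connected ^~ oe) xJ yJ Hk k1 kJ.
  by exists M => N w _ _ _ i _; apply: hM.
have lk h h' : H h -> H h' -> linked F h h'.
  by move=> Hh Hh'; apply: generated_linked; rewrite -HE; apply: HM => //; apply: HV.
apply: (@stability H (cdist F 1) (\max_(s <- F) len s)) => //.
- move=> k Hk; have [p [pP pk <-]] := cdist_path (lk _ _ H1 Hk).
  case: p pP pk => [|h [|//]] /=; first by move=> _ <-; rewrite len1.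
  rewrite andbT /cayley_adj invg1 mul1g mulg1 => /andP[_ hF] <- _.
  by case/orP: hF => hF; [|rewrite -lenV]; apply: (leq_bigmax_seq _ hF).
- by move=> k h Hk Hh; apply: HM => //; apply: HV.
- move=> B; have [|k _|D DP] := @bounded_seq _ (ball B) (fun k D => H k -> cdist F 1 k <= D).
  + by move=> k i j ij h /h/leq_trans; apply.
  + by exists (cdist F 1 k).
  + by exists D => k Hk /mem_ball/DP; apply.
move=> h h' Hh Hh'; have [f [f0 fn fP]] := cdist_geodesic (lk _ _ Hh Hh').
exists (cdist F h h'), f; split=> // i j ij.
have Hf t : t <= cdist F h h' -> H (f t).
  move=> tn; have [|lt0 _] := fP 0 t; first by rewrite tn.
  have := linked_generated lt0; rewrite -HE f0 => Ht.
  by rewrite -(mulVKg h (f t)); apply: HM.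
have [lij dij] := fP i j ij; have [Hi Hj] : H (f i) /\ H (f j) by split; apply: Hf; lia.
split=> //; first by apply: HM => //; apply: HV.
by rewrite -dij -(cdistM (f i)^-1 lij) mulVg.
Qed.

End Raag.

Theorem proposition3 (R : realType) (V : finType) (e : rel V)
    (e_sym : symmetric e) (e_irr : irreflexive e)
    (A_one_ended : one_ended (raag e))
    (H : set (raag e)) (H_sub : is_subgroup H)
    (H_fg : finitely_generated H) :
  strongly_quasiconvex R H <-> finite_height H.
Proof.
split; first exact: strongly_quasiconvex_finite_height.
(* For the vertex generators the Cayley graph distance is [dist], in which stability was
   obtained. *)
move=> Hfin; apply: (@nat_strongly_quasiconvex R (raag e) _ (vertex_gens_generate e_sym e_irr) H).
move=> K C; have [M hM] := finite_height_stability e_sym e_irr A_one_ended H_sub H_fg Hfin K C.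
exists M => N w qw Hw0 HwN i iN.
have [|h Hh wh] := hM N w _ Hw0 HwN i iN.
  by move=> j j' /qw; rewrite cdist_vertex_gens.
by exists h; rewrite ?cdist_vertex_gens.
Qed.
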